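(* Let $\Bbbk$ be a field, $S=\Bbbk[x_1,\ldots,x_n]$, let $I\subset S$ be a radical ideal (not necessarily homogeneous) with primary decomposition $I=\mathfrak{p}_1\cap\ldots\cap\mathfrak{p}_s$ (where $\mathfrak{p}_1,\ldots,\mathfrak{p}_s$ are the minimal primes of $I$), and let $\prec$ be a term order on $S$. If $\mathrm{in}_{\prec}\left(\bigcap_{i\in A}\mathfrak{p}_i\right)$ is radical for all $A\subseteq\{1,\ldots,s\}$, then $$\operatorname{diam}(I)\leq\operatorname{diam}(\mathrm{in}_{\prec} I).$$
   Context: $\mathrm{in}_\prec J$ is the initial ideal of $J$, generated by the initial monomials of the nonzero elements of $J$. For a proper ideal $J\subset S$ with minimal primes $\mathfrak{q}_1,\ldots,\mathfrak{q}_t$, the dual graph $G(J)$ is the simple graph with vertex set $\{1,\ldots,t\}$ in which $\{i,j\}$ (with $i\ne j$) is an edge if and only if $\operatorname{height}(\mathfrak{q}_i+\mathfrak{q}_j)=\operatorname{height}(J)+1$ (the unit ideal is regarded as having height $\infty$). The diameter $\operatorname{diam}(J)$ is the diameter of the graph $G(J)$: the maximum over pairs of vertices of their distance, where the distance of two vertices is the minimum number of edges in a path connecting them ($0$ if they are equal, $\infty$ if no path connects them). The diameter may be $\infty$, and the inequality is in $\mathbb{N}\cup\{\infty\}$. *)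

(* Defs.v *)
From HB Require Import structures.
From mathcomp Require Import all_boot all_order all_algebra.
From mathcomp Require Import boolp classical_sets.
From mathcomp Require Import mpoly.

Set Implicit Arguments.
Unset Strict Implicit.
Unset Printing Implicit Defensive.

Import GRing.Theory.
Local Open Scope ring_scope.
Local Open Scope classical_set_scope.

(* N \cup {oo} *)
Inductive enat : Type := Fin of nat | Infty.

Definition enat_le (x y : enat) : bool :=
  match x, y with
  | _, Infty => true
  | Infty, Fin _ => false
  | Fin m, Fin n => (m <= n)%N
  end.

Definition enat_succ (x : enat) : enat :=
  if x is Fin n then Fin n.+1 else Infty.

Definition enat_inf (A : set enat) : enat :=
  if pselect (exists n, `[< A (Fin n) >]) is left h then Fin (ex_minn h)
  else Infty.

Definition enat_sup (A : set enat) : enat :=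
  enat_inf [set y | forall x, A x -> enat_le x y].

Lemma enat_inf_lb (A : set enat) x : A x -> enat_le (enat_inf A) x.
Proof.
case: x => [n|]; last by case: (enat_inf A).
rewrite /enat_inf => An; case: pselect => [h|[]]; last by exists n; apply/asboolP.
by case: ex_minnP => m _; apply; apply/asboolP.
Qed.

Lemma enat_inf_glb (A : set enat) y :
  (forall x, A x -> enat_le y x) -> enat_le y (enat_inf A).
Proof.
rewrite /enat_inf => yA; case: pselect => [h|_]; last by case: y yA.
by case: ex_minnP => m /asboolP /yA.
Qed.

Lemma enat_sup_ub (A : set enat) x : A x -> enat_le x (enat_sup A).
Proof. by move=> Ax; apply: enat_inf_glb => y; apply. Qed.

Lemma enat_sup_lub (A : set enat) y :
  (forall x, A x -> enat_le x y) -> enat_le (enat_sup A) y.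
Proof. exact: enat_inf_lb. Qed.

(* [path e u w] says that u :: w is a walk; a shortest walk is a path, and
   [size w] is its number of edges. *)
Definition graph_dist (V : Type) (e : rel V) (u v : V) : enat :=
  enat_inf [set Fin (size w) | w in [set w | path e u w /\ last u w = v]].

Definition graph_diam (V : Type) (e : rel V) : enat :=
  enat_sup [set graph_dist e uv.1 uv.2 | uv in [set: V * V]].

(* Unlike [idealr_closed] of ring_quotient, the unit ideal is allowed. *)
Definition is_ideal (R : comNzRingType) (J : set R) : Prop :=
  [/\ J 0, (forall f g, J f -> J g -> J (f + g))
    & forall a f, J f -> J (a * f)].

Definition is_proper (R : comNzRingType) (J : set R) : Prop := ~ J 1.

(* The unit ideal is radical. *)
Definition is_radical (R : comNzRingType) (J : set R) : Prop :=
  forall (f : R) (m : nat), J (f ^+ m) -> J f.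

Definition is_prime (R : comNzRingType) (q : set R) : Prop :=
  [/\ is_ideal q, is_proper q & forall f g, q (f * g) -> q f \/ q g].

Definition ideal_sum (R : comNzRingType) (J K : set R) : set R :=
  [set f + g | f in J & g in K].

Definition ideal_gen (R : comNzRingType) (G : set R) : set R :=
  smallest (@is_ideal R) G.

Definition minimal_prime (R : comNzRingType) (J q : set R) : Prop :=
  [/\ is_prime q, J `<=` q
    & forall q', is_prime q' -> J `<=` q' -> q' `<=` q -> q' = q].

Definition prime_height (R : comNzRingType) (q : set R) : enat :=
  enat_sup [set Fin k | k in [set k | exists c : nat -> set R,
    [/\ forall i, (i <= k)%N -> is_prime (c i),
        forall i, (i < k)%N -> c i `<` c i.+1 & c k = q]]].

(* For the unit ideal this is the infimum of the empty set, that is oo. *)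
Definition ideal_height (R : comNzRingType) (J : set R) : enat :=
  enat_inf [set prime_height q | q in [set q | is_prime q /\ J `<=` q]].

Definition dual_graph (R : comNzRingType) (J : set R) :
    rel {q : set R | minimal_prime J q} :=
  fun q1 q2 => `[< sval q1 <> sval q2 /\
    ideal_height (ideal_sum (sval q1) (sval q2))
      = enat_succ (ideal_height J) >].

Definition ideal_diam (R : comNzRingType) (J : set R) : enat :=
  graph_diam (@dual_graph R J).

(* [le m1 m2] compares the monomials 'X_[m1] and 'X_[m2]; 0%MM is the exponent
   of the monomial 1. *)
Definition term_order (n : nat) (le : rel 'X_{1..n}) : Prop :=
  [/\ reflexive le, antisymmetric le, transitive le & total le] /\
  [/\ forall m, le 0%MM m
    & forall m m1 m2, le m1 m2 -> le (m1 + m)%MM (m2 + m)%MM].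

Definition initial_exponent (k : fieldType) (n : nat) (le : rel 'X_{1..n})
    (f : {mpoly k[n]}) (m : 'X_{1..n}) : Prop :=
  m \in msupp f /\ forall m', m' \in msupp f -> le m' m.

(* As msupp 0 is empty, the zero polynomial contributes no generator. *)
Definition initial_ideal (k : fieldType) (n : nat) (le : rel 'X_{1..n})
    (J : set {mpoly k[n]}) : set {mpoly k[n]} :=
  ideal_gen [set g | exists f m,
    [/\ J f, initial_exponent le f m & g = 'X_[m]]].

(* Main.v *)
Require Import Defs.
From HB Require Import structures.
From mathcomp Require Import all_boot all_order all_algebra.
From mathcomp Require Import boolp classical_sets.
From mathcomp Require Import mpoly.
From mathcomp Require Import zify lra.
Local Open Scope classical_set_scope.

(** Let [S] be the polynomial ring, [h] the height of [I], and write [in J] for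
the initial ideal of [J]. A vertex [Q] of the dual graph of [in I] contains
[in p_l] for at least one [l], because [in I] contains the product of the
[in p_l]. Suppose that [Q] and [Q'] are adjacent, [Q] contains [in p_l], [Q']
contains [in p_l'] and [l <> l']. Then [p_l] and [p_l'] are adjacent in the dual
graph of [I]: the height of [p_l + p_l'] is at least [h + 1], since a prime
containing the sum contains [p_l] properly, and it is at most the height of
[Q + Q'], which is [height (in I) + 1 <= h + 1] ([height_sum_adjacent]). So a walk
in the dual graph of [in I] projects to a walk in the dual graph of [I] that is
not longer ([lift_walk]). Every component is reached in this way: as [in I] is
radical and differs from the initial ideal of the intersection of the [p_l] with
[l <> v], some minimal prime of [in I] contains [in p_v] and no other [in p_l]
([private_minimal_prime]).

The radicality hypothesis enters through pairs of components. It gives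
[in p_l `&` in p_l' = in (p_l `&` p_l')], and therefore cancellation of leading terms
in a sum [f + g] with [f] in [p_l] and [g] in [p_l'] can be undone by an element of
the intersection; so every leading monomial of [p_l + p_l'] is one of [p_l] or of
[p_l'] ([lead_ideal_sum]). Hence a prime [q] that contains [in p_l] and [in p_l']
contains all leading monomials of the sum, and the height of [p_l + p_l'] is at
most that of [q] ([height_sum_le]).

Heights are compared through sets [U] of variables that are independent modulo
an ideal [J], which means that [J] meets the polynomials in the variables of [U]
only in [0]. A prime [q] has an independent set with at least [n - height q]
elements ([prime_independent_set]), and an ideal with an independent set [U] has
height at most [n - #|U|] ([ideal_height_independent]). The last bound, and the
passage from independence modulo [J] to independence modulo [in J], both follow
from one dimension count ([algebraic_dependence]): if every set of [N + 1] variables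
supports a leading monomial of [J], then any [N + 1] polynomials are algebraically
dependent modulo [J]. For [J = 0] and [N = n] this says that the transcendence
degree of [S] is at most [n]. *)

Set Implicit Arguments.
Unset Strict Implicit.
Unset Printing Implicit Defensive.

(** * Extended natural numbers *)
Section ExtendedNaturals.

Lemma enat_le_trans y x z : enat_le x y -> enat_le y z -> enat_le x z.
Proof. by case: x y z => [a|] [b|] [c|] //=; apply: leq_trans. Qed.

Lemma enat_le_anti x y : enat_le x y -> enat_le y x -> x = y.
Proof.
by case: x y => [a|] [b|] //= ab ba; congr Fin; apply/eqP; rewrite eqn_leq ab.
Qed.

Lemma enat_le_succ2 x y : enat_le x y -> enat_le (enat_succ x) (enat_succ y).
Proof. by case: x y => [a|] [b|]. Qed.

Lemma enat_inf_attained (A : set enat) d :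
  enat_le (enat_inf A) (Fin d) -> exists2 m, (m <= d)%N & A (Fin m).
Proof.
rewrite /enat_inf; case: pselect => // h.
by case: ex_minnP => m /asboolP Am _ /= md; exists m.
Qed.

End ExtendedNaturals.

(** * Ideals, primes and chains of primes *)
Section Primes.
Local Open Scope ring_scope.
Import GRing.Theory.
Variable R : comNzRingType.
Implicit Types (J K q : set R).

Lemma is_ideal0 J : is_ideal J -> J 0. Proof. by case. Qed.
Lemma is_idealD J f g : is_ideal J -> J f -> J g -> J (f + g).
Proof. by case=> _ + _; apply. Qed.
Lemma is_idealMl J a f : is_ideal J -> J f -> J (a * f).
Proof. by case=> _ _; apply. Qed.
Lemma is_idealMr J a f : is_ideal J -> J f -> J (f * a).
Proof. by rewrite mulrC; apply: is_idealMl. Qed.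
Lemma is_idealN J f : is_ideal J -> J f -> J (- f).
Proof. by rewrite -mulN1r; apply: is_idealMl. Qed.
Lemma is_idealB J f g : is_ideal J -> J f -> J g -> J (f - g).
Proof. by move=> iJ Jf Jg; apply: is_idealD => //; apply: is_idealN. Qed.
Lemma ideal_sumr J (T : Type) (r : seq T) (P : pred T) (F : T -> R) :
  is_ideal J -> (forall i, P i -> J (F i)) -> J (\sum_(i <- r | P i) F i).
Proof.
move=> iJ JF; apply: (big_ind J) => //; first exact: is_ideal0.
by move=> x y; apply: is_idealD.
Qed.

Lemma is_ideal_sum J K : is_ideal J -> is_ideal K -> is_ideal (ideal_sum J K).
Proof.
move=> iJ iK; split.
- by exists 0; [exact: is_ideal0 | exists 0; [exact: is_ideal0 | rewrite addr0]].
- move=> _ _ [a Ja [b Kb <-]] [c Jc [d Kd <-]].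
  exists (a + c); first exact: is_idealD.
  by exists (b + d); [exact: is_idealD | rewrite addrACA].
- move=> c _ [a Ja [b Kb <-]].
  exists (c * a); first exact: is_idealMl.
  by exists (c * b); [exact: is_idealMl | rewrite mulrDr].
Qed.

Lemma ideal_sumSl J K : is_ideal K -> J `<=` ideal_sum J K.
Proof.
by move=> iK f Jf; exists f => //; exists 0; [exact: is_ideal0 | rewrite addr0].
Qed.

Lemma ideal_sumSr J K : is_ideal J -> K `<=` ideal_sum J K.
Proof.
by move=> iJ f Kf; exists 0; [exact: is_ideal0 | exists f => //; rewrite add0r].
Qed.

Lemma is_ideal_bigcap (T : Type) (A : set T) (F : T -> set R) :
  (forall i, A i -> is_ideal (F i)) -> is_ideal (\bigcap_(i in A) F i).
Proof.
move=> iF; split=> [i Ai|f g Ff Fg i Ai|a f Ff i Ai].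
- exact: is_ideal0 (iF i Ai).
- by apply: is_idealD (iF i Ai) _ _; [exact: Ff | exact: Fg].
- by apply: is_idealMl (iF i Ai) _; exact: Ff.
Qed.

Lemma is_ideal_setI J K : is_ideal J -> is_ideal K -> is_ideal (J `&` K).
Proof.
move=> iJ iK; split.
- by split; exact: is_ideal0.
- by move=> f g [? ?] [? ?]; split; exact: is_idealD.
- by move=> a f [? ?]; split; exact: is_idealMl.
Qed.

Lemma is_ideal_gen (G : set R) : is_ideal (ideal_gen G).
Proof. by apply: is_ideal_bigcap => K []. Qed.

Lemma prime_idealW q : is_prime q -> is_ideal q. Proof. by case. Qed.

Definition mult_closed (W : set R) := W 1 /\ forall f g, W f -> W g -> W (f * g).

(** An ideal [q] that is maximal among those containing [J] and missing [W] is
prime: if neither [f] nor [g] lies in [q], both [q + (f)] and [q + (g)] meet [W],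
hence so does [q + (f * g)]. *)
Lemma prime_avoiding J (W : set R) :
  is_ideal J -> mult_closed W -> J `&` W `<=` set0 ->
  exists q, [/\ is_prime q, J `<=` q & q `&` W `<=` set0].
Proof.
move=> iJ [W1 WM] JW.
pose good K := [/\ is_ideal K, J `<=` K & K `&` W `<=` set0].
(* The empty set is admitted because it is the union of the empty chain. *)
have [F Fgood totF|q [goodq maxq]] := @Zorn_bigcup R (fun K => K = set0 \/ good K).
  have [[K FK gK]|noF] := pselect (exists2 K, F K & good K); last first.
    left; apply/seteqP; split=> // f [K FK Kf].
    by case: (Fgood K FK) => [K0|gK]; [rewrite -K0 | case: noF; exists K].
  right; split.
  - split.
    + by exists K => //; case: gK => iK _ _; exact: is_ideal0.
    + move=> f g [A FA Af] [B FB Bg].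
      have iF C h : F C -> C h -> is_ideal C.
        by move=> FC Ch; case: (Fgood C FC) => [C0|[]//]; rewrite C0 in Ch.
      by have [AB|BA] := totF _ _ FA FB; [exists B | exists A] => //;
        apply: is_idealD (iF _ _ _ _) _ _; eauto.
    + move=> a f [A FA Af]; exists A => //.
      by case: (Fgood A FA) => [A0|[iA _ _]]; [rewrite A0 in Af | exact: is_idealMl].
  - by move=> f Jf; exists K => //; case: gK => _ + _; apply.
  - move=> f [[A FA Af] Wf].
    by case: (Fgood A FA) => [A0|[_ _ AW]]; [rewrite A0 in Af | apply: (AW f)].
have {goodq}[iq Jq qW] : good q.
  case: goodq => // q0; case: (maxq J); last by right; split.
  rewrite q0; split; first exact: sub0set.
  by move=> /(_ 0); apply; exact: is_ideal0.
have meets f : ~ q f -> exists a b, q a /\ W (a + b * f).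
  move=> nqf; apply: contrapT => no.
  pose K := [set g | exists a b, q a /\ g = a + b * f].
  have qK : q `<=` K by move=> a qa; exists a, 0; rewrite mul0r addr0.
  apply: (maxq K).
    split=> // Kq; apply: nqf; apply: Kq.
    by exists 0, 1; rewrite add0r mul1r; split=> //; exact: is_ideal0.
  right; split; first split.
  - exact: qK (is_ideal0 iq).
  - move=> _ _ [a [b [qa ->]]] [c [d [qc ->]]]; exists (a + c), (b + d).
    by rewrite mulrDl addrACA; split=> //; exact: is_idealD.
  - move=> c _ [a [b [qa ->]]]; exists (c * a), (c * b).
    by rewrite mulrDr mulrA; split=> //; exact: is_idealMl.
  - exact: subset_trans Jq qK.
  - by move=> _ [[a [b [qa ->]]] Wg]; apply: no; exists a, b.
exists q; split=> //; split=> //.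
  by move=> q1; apply: (qW 1).
move=> f g qfg; apply: contrapT => /not_orP[/meets[a [b [qa Wf]]] /meets[c [d [qc Wg]]]].
apply: (qW ((a + b * f) * (c + d * g))); split; last exact: WM.
rewrite mulrDl; apply: is_idealD => //; first exact: is_idealMr.
rewrite mulrDr; apply: is_idealD => //; first exact: is_idealMl.
by rewrite mulrACA; apply: is_idealMl.
Qed.

(** The chains whose lengths [prime_height] takes the supremum of. A lower bound
for a height comes from growing one chain, an upper bound from all of them. *)
Definition prime_chain k q := exists c : nat -> set R,
  [/\ forall i, (i <= k)%N -> is_prime (c i),
      forall i, (i < k)%N -> c i `<` c i.+1 & c k = q].

Lemma prime_chain0 q : is_prime q -> prime_chain 0 q.
Proof. by move=> qP; exists (fun=> q); split. Qed.

Lemma prime_chainS k q q' :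
  prime_chain k q -> is_prime q' -> q `<` q' -> prime_chain k.+1 q'.
Proof.
move=> [c [cP cS <-]] q'P qq'; exists (fun i => if (i <= k)%N then c i else q').
split=> [i ik|i|]; [by case: ifP => // /cP | rewrite ltnS => ik | by rewrite ltnn].
rewrite ik; case: ltnP => ik'; first exact: cS.
by have -> : i = k by apply/eqP; rewrite eqn_leq ik.
Qed.

(** If the inclusion is proper, [q'] takes the place of [q] at the end of the
chain, so that no length is lost. *)
Lemma prime_chain_sub k q q' :
  prime_chain k q -> is_prime q' -> q `<=` q' -> prime_chain k q'.
Proof.
case: k => [|k] [c [cP cS cq]] q'P qq'; first exact: prime_chain0.
apply: (@prime_chainS k (c k)) => //.
  exists c; split=> // i ik; [apply: cP | apply: cS]; exact: leqW.
have [ck kc] := cS k (ltnSn k); rewrite cq in ck kc.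
by split=> [|q'c]; [exact: subset_trans qq' | apply: kc; exact: subset_trans q'c].
Qed.

Lemma prime_chain_le k q : prime_chain k q -> enat_le (Fin k) (prime_height q).
Proof. by move=> qk; apply: enat_sup_ub; exists k. Qed.

Lemma prime_height_le q x :
  (forall k, prime_chain k q -> enat_le (Fin k) x) -> enat_le (prime_height q) x.
Proof. by move=> qx; apply: enat_sup_lub => _ [k qk <-]; exact: qx. Qed.

End Primes.

(** * Positive integer weights for a term order *)
Section Weights.
Local Open Scope ring_scope.
Import Order.TTheory GRing.Theory Num.Theory.

Lemma seq_lower_bound (F : realFieldType) (s : seq F) :
  exists x, forall b, b \in s -> x < b.
Proof.
elim: s => [|b s [x xs]]; first by exists 0.
exists (Num.min x (b - 1)) => c; rewrite inE => /predU1P[->|/xs xc].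
  by rewrite gt_min; apply/orP; right; lra.
by rewrite gt_min xc.
Qed.

Lemma seq_lower_bound_gt (F : realFieldType) (a : F) (s : seq F) :
  (forall b, b \in s -> a < b) -> exists2 x, a < x & forall b, b \in s -> x < b.
Proof.
elim: s => [|b s IH] ab; first by exists (a + 1) => //; lra.
have [c cs|x ax xs] := IH; first by apply: ab; rewrite inE cs orbT.
have aLb : a < b by apply: ab; rewrite mem_head.
exists (Num.min x ((a + b) / 2)) => [|c].
  by rewrite lt_min ax /=; lra.
rewrite inE => /predU1P[->|/xs xc]; last by rewrite gt_min xc.
by rewrite gt_min; apply/orP; right; lra.
Qed.

Lemma seq_separation (F : realFieldType) (r s : seq F) :
  (forall a b, a \in r -> b \in s -> a < b) ->
  exists x, (forall a, a \in r -> a < x) /\ (forall b, b \in s -> x < b).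
Proof.
elim: r => [|a r IH] rs; first by have [x xs] := seq_lower_bound s; exists x.
have [c b cr bs|x [rx xs]] := IH; first by apply: rs => //; rewrite inE cr orbT.
have [ax|xa] := ltP a x.
  by exists x; split=> // c; rewrite inE => /predU1P[->|/rx].
have [b bs|y ay ys] := @seq_lower_bound_gt F a s.
  by apply: rs => //; rewrite mem_head.
exists y; split=> // c; rewrite inE => /predU1P[->//|/rx cx].
exact: lt_trans cx (le_lt_trans xa ay).
Qed.

Lemma mulrn_absz_cancel (a b : int) :
  0 < a -> b < 0 -> a *+ absz b + b *+ absz a = 0.
Proof.
move=> a0 b0.
have ea : a = absz a by lia.
have eb : b = - (absz b)%:Z by lia.
rewrite {1}ea {2}eb mulNrn -[X in X - _]mulr_natr natz -[X in _ - X]mulr_natr natz.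
by rewrite mulrC subrr.
Qed.

(** Fourier-Motzkin elimination, one coordinate at a time; [C] is the positive
cone of an order on the group of integer vectors. *)
Lemma positive_functional n (C : set 'rV[int]_n) (s : seq 'rV[int]_n) :
    ~ C 0 -> (forall u v, C u -> C v -> C (u + v)) ->
    (forall m u, C u -> C (u *+ m.+1)) -> (forall v, v \in s -> C v) ->
  exists w : 'I_n -> rat, forall v, v \in s -> 0 < \sum_i w i * (v 0 i)%:~R.
Proof.
move=> C0 CD CM.
suff main r (le_rn : (r <= n)%N) : forall s : seq 'rV[int]_n,
    (forall v, v \in s -> C v /\ forall i : 'I_n, (r <= i)%N -> v 0 i = 0) ->
    exists w : 'I_n -> rat, forall v, v \in s -> 0 < \sum_i w i * (v 0 i)%:~R.
  by move=> sC; apply: (main n) => // v /sC Cv; split=> // i; rewrite leqNgt ltn_ord.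
elim: r le_rn => [|r IH] le_rn {}s sC.
  exists (fun=> 0) => v /sC[Cv v0]; case: C0.
  suff v_eq0 : v = 0 by rewrite v_eq0 in Cv.
  by apply/rowP => i; rewrite v0 // mxE.
pose i0 := Ordinal le_rn.
pose pos := [seq v : 'rV[int]_n <- s | 0 < v 0 i0].
pose neg := [seq v : 'rV[int]_n <- s | v 0 i0 < 0].
(* The positive combinations in which the coordinate [i0] cancels. *)
pose mix (u v : 'rV[int]_n) := u *+ `|v 0 i0| + v *+ `|u 0 i0|.
have [|w w_gt0] := IH (ltnW le_rn)
    ([seq v : 'rV[int]_n <- s | v 0 i0 == 0] ++ [seq mix u v | u <- pos, v <- neg]).
  move=> v; rewrite mem_cat => /orP[|/allpairsP[[u t] /= []]].
    rewrite mem_filter => /andP[/eqP v0 /sC[Cv vr]]; split=> // i.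
    rewrite leq_eqVlt => /predU1P[ri|/vr//].
    by rewrite -v0; congr (v 0 _); apply: val_inj.
  rewrite !mem_filter => /andP[u0 /sC[Cu ur]] /andP[t0 /sC[Ct tr]] ->; split.
    have absK (z : int) : z != 0 -> absz z = (absz z).-1.+1 by lia.
    by apply: CD; rewrite absK ?(gt_eqF u0) ?(lt_eqF t0) //; exact: CM.
  move=> i; rewrite leq_eqVlt => /predU1P[ri|ri]; last first.
    by rewrite !mxE !mulmxnE (ur i) // (tr i) // !mul0rn addr0.
  have <- : i0 = i by apply: val_inj.
  rewrite !mxE !mulmxnE.
  exact: mulrn_absz_cancel.
pose L (v : 'rV[int]_n) : rat := \sum_i w i * (v 0 i)%:~R.
have LD u v : L (u + v) = L u + L v.
  by rewrite -big_split; apply: eq_bigr => i _; rewrite mxE intrD mulrDr.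
have LM u m : L (u *+ m) = L u *+ m.
  elim: m => [|m IHm]; first by rewrite /L big1 // => i _; rewrite mulmxnE mulr0.
  by rewrite !mulrS LD IHm.
(* [w] is corrected at [i0] by some [x], which the vectors of [pos] bound from
   below and those of [neg] from above; positivity on [mix u v] says precisely
   that these bounds are compatible. *)
pose bounds (vs : seq 'rV[int]_n) := [seq - L v / (v 0 i0)%:~R | v : 'rV_n <- vs].
have [x [xpos xneg]] : exists x,
    (forall a, a \in bounds pos -> a < x) /\ (forall b, b \in bounds neg -> x < b).
  apply: seq_separation => _ _ /mapP[u upos ->] /mapP[v vneg ->].
  have := w_gt0 (mix u v).
  rewrite mem_cat (allpairs_f mix upos vneg) orbT -/(L _) LD !LM => /(_ isT).
  move: upos vneg; rewrite !mem_filter => /andP[u0 _] /andP[v0 _].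
  set U := (u 0 i0)%:~R; set V := (v 0 i0)%:~R.
  have U0 : 0 < U :> rat by rewrite ltr0z.
  have V0 : V < 0 :> rat by rewrite ltrz0.
  have absU : `|u 0 i0|%:R = U by rewrite -[LHS]/((`|u 0 i0|%:Z)%:~R) gez0_abs // ltW.
  have absV : `|v 0 i0|%:R = - V.
    by rewrite -[LHS]/((`|v 0 i0|%:Z)%:~R) ltz0_abs // mulrNz.
  rewrite -mulr_natr absV -(mulr_natr (L v)) absU => LUV.
  rewrite ltr_pdivrMr // mulrAC ltr_ndivlMr // .
  nra.
exists (fun i => w i + (i == i0)%:R * x) => v vs.
have -> : \sum_i (w i + (i == i0)%:R * x) * (v 0 i)%:~R = L v + x * (v 0 i0)%:~R.
  under eq_bigr => i _ do rewrite mulrDl.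
  rewrite big_split /=; congr (_ + _); rewrite (bigD1 i0) //= eqxx mul1r big1 ?addr0 //.
  by move=> i /negPf ->; rewrite !mul0r.
have [v0|v0|v0] := ltgtP (v 0 i0) 0.
- have : x < - L v / (v 0 i0)%:~R by apply: xneg; apply: map_f; rewrite mem_filter v0.
  by rewrite ltr_ndivlMr ?ltrz0 //; lra.
- have : - L v / (v 0 i0)%:~R < x by apply: xpos; apply: map_f; rewrite mem_filter v0.
  by rewrite ltr_pdivrMr ?ltr0z //; lra.
- by rewrite v0 mulr0 addr0; apply: w_gt0; rewrite mem_cat mem_filter v0 eqxx vs.
Qed.

(** [D] is the product of the denominators. *)
Lemma clear_denominators n (w : 'I_n -> rat) : (forall i, 0 < w i) ->
  exists (W : 'I_n -> nat) (D : rat), 0 < D /\ forall i, (W i)%:R = w i * D.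
Proof.
move=> w0; exists (fun i => `|numq (w i)| * \prod_(j | j != i) `|denq (w j)|)%N.
exists (\prod_i (denq (w i))%:~R); split; first by apply: prodr_gt0 => i _; rewrite ltr0z.
have absq j : `|denq (w j)|%:R = (denq (w j))%:~R :> rat.
  by rewrite -[LHS]/((`|denq (w j)|%:Z)%:~R) absz_denq.
move=> i; rewrite natrM [in RHS](bigD1 i) //= mulrA natr_prod; congr (_ * _); last first.
  by apply: eq_bigr => j _.
rewrite -numqE -[LHS]/((`|numq (w i)|%:Z)%:~R) gez0_abs // numq_ge0 ltW //.
Qed.

End Weights.

Lemma seq_maximum (T : eqType) (r : rel T) (x : T) (s : seq T) :
    reflexive r -> transitive r -> total r -> x \in s ->
  exists2 b, b \in s & forall a, a \in s -> r a b.
Proof.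
move=> r_refl r_trans r_total.
elim: s x => // c s IH x _; case: s IH => [|d s] IH.
  by exists c => [|a]; rewrite ?mem_head // inE => /eqP ->.
have [b bs bP] := IH d (mem_head _ _).
have [cb|bc] := orP (r_total c b).
  by exists b => [|a]; rewrite inE ?bs ?orbT // => /predU1P[->|/bP].
exists c => [|a]; rewrite ?mem_head // inE => /predU1P[->//|/bP ab].
exact: r_trans ab bc.
Qed.
Section TermOrders.
Import Order.TTheory GRing.Theory Num.Theory.
Local Open Scope ring_scope.
Variables (n : nat) (le : rel 'X_{1..n}).
Hypothesis ordle : term_order le.
Implicit Types (a b m : 'X_{1..n}).

Let le_refl : reflexive le. Proof. by case: ordle => -[]. Qed.
Let le_anti : antisymmetric le. Proof. by case: ordle => -[]. Qed.
Let le_trans : transitive le. Proof. by case: ordle => -[]. Qed.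
Let le_total : total le. Proof. by case: ordle => -[]. Qed.

Lemma term_order_add a b c d : le a b -> le c d -> le (a + c)%MM (b + d)%MM.
Proof.
have [_ [_ leD]] := ordle => ab cd; apply: le_trans (leD c _ _ ab) _.
by rewrite ![(b + _)%MM]addmC; apply: leD.
Qed.

Lemma term_order_add_eq a b c d :
  le a b -> le c d -> (a + c = b + d)%MM -> a = b /\ c = d.
Proof.
move=> ab cd e; have [_ [_ leD]] := ordle.
have ba : le (b + c)%MM (a + c)%MM.
  by rewrite e ![(b + _)%MM]addmC; apply: leD.
have eab : (a + c = b + c)%MM by apply: le_anti; rewrite ba andbT; exact: leD.
have ab' : a = b by apply: addIm eab.
by split=> //; move: e; rewrite ab' => /addmI.
Qed.

Lemma term_order_dvd a b : (a <= b)%MM -> le a b.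
Proof.
move=> ab; rewrite -(submK ab) -{1}[a]add0m.
by have [_ [le0 leD]] := ordle; apply/leD/le0.
Qed.

Lemma term_order_seq_max m (s : seq 'X_{1..n}) : m \in s ->
  exists2 b, b \in s & forall a, a \in s -> le a b.
Proof. exact: seq_maximum. Qed.

Definition weighted_degree (W : 'I_n -> nat) m := (\sum_i W i * m i)%N.

(** A term order need not refine any degree, and it may put infinitely many
monomials below a given one; on finitely many pairs it is nevertheless induced
by positive integer weights. The pairs [(U_(i), 0)] are adjoined to make the
weights positive. *)
Lemma term_order_weight (s : seq ('X_{1..n} * 'X_{1..n})) :
    (forall ab, ab \in s -> le ab.2 ab.1 /\ ab.2 <> ab.1) ->
  exists W : 'I_n -> nat, (forall i, (0 < W i)%N) /\
    forall ab, ab \in s -> (weighted_degree W ab.2 < weighted_degree W ab.1)%N.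
Proof.
move=> sP.
pose dif (ab : 'X_{1..n} * 'X_{1..n}) : 'rV[int]_n :=
  \row_i ((ab.1 i)%:Z - (ab.2 i)%:Z).
pose above ab := le ab.2 ab.1 /\ ab.2 <> ab.1.
have difD ab cd : dif ab + dif cd = dif ((ab.1 + cd.1)%MM, (ab.2 + cd.2)%MM).
  by apply/rowP => i; rewrite !mxE /= !mnmDE !PoszD opprD addrACA.
have aboveD ab cd : above ab -> above cd -> above ((ab.1 + cd.1)%MM, (ab.2 + cd.2)%MM).
  move=> [ab1 ab2] [cd1 cd2]; split; first exact: term_order_add.
  by move=> /(term_order_add_eq ab1 cd1)[].
have [|||| w wP] := @positive_functional n [set dif ab | ab in above]
  ([seq dif ab | ab <- s] ++ [seq dif (U_(i)%MM, 0%MM) | i <- enum 'I_n]).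
- move=> [[a b] [_ ab] /rowP d0]; apply: ab; apply/mnmP => i.
  by have := d0 i; rewrite !mxE /=; lia.
- move=> _ _ [ab abP <-] [cd cdP <-]; rewrite difD.
  by exists ((ab.1 + cd.1)%MM, (ab.2 + cd.2)%MM) => //; exact: aboveD.
- move=> m _ [ab abP <-]; elim: m => [|m [cd cdP IH]]; first by exists ab.
  rewrite mulrS -IH difD.
  by exists ((ab.1 + cd.1)%MM, (ab.2 + cd.2)%MM) => //; exact: aboveD.
- move=> v; rewrite mem_cat => /orP[/mapP[ab abs ->]|/mapP[i _ ->]].
    by exists ab => //; apply: sP.
  exists (U_(i)%MM, 0%MM) => //; split=> /=.
    by apply/term_order_dvd/mnm_lepP => j; rewrite mnm0E.
  by move=> /esym/eqP; rewrite mnm1_eq0.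
have w0 i : 0 < w i.
  have : 0 < \sum_j w j * (dif (U_(i)%MM, 0%MM) 0 j)%:~R.
    apply: wP; rewrite mem_cat; apply/orP; right.
    by apply/mapP; exists i; rewrite ?mem_enum.
  rewrite (bigD1 i) //= big1 => [|j ji]; rewrite !mxE /= mnm0E subr0 mnm1E.
    by rewrite eqxx mulr1 ?addr0.
  by rewrite eq_sym (negPf ji) mulr0.
have [W [D [D0 WD]]] := clear_denominators w0.
exists W; split=> [i|ab abs].
  by rewrite -(ltr_nat rat) WD pmulr_lgt0.
have /= := wP (dif ab); rewrite mem_cat (map_f dif abs) => /(_ isT).
rewrite -(pmulr_lgt0 _ D0) mulr_suml => pos.
rewrite -(ltr_nat rat) -subr_gt0 !natr_sum -sumrB.
rewrite (eq_bigr (fun i => w i * (dif ab 0 i)%:~R * D)) // => i _.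
by rewrite !natrM -mulrBr WD mxE intrB mulrAC.
Qed.

(** Induction on the number [r] of coordinates that are compared. Let [s] do for
[r] coordinates, with coordinate [r] below [B] on [s]. A member of [P] whose
coordinate [r] is at least [B] is above an element of [s]; the others fall into
the [B] slices where that coordinate is constant, to which the induction
hypothesis applies again. *)
Lemma dickson (P : set 'X_{1..n}) : exists s : seq 'X_{1..n},
  (forall a, a \in s -> P a) /\
  forall m, P m -> exists2 a, a \in s & (a <= m)%MM.
Proof.
suff main r (le_rn : (r <= n)%N) : forall Q : set 'X_{1..n}, exists s : seq 'X_{1..n},
    (forall a, a \in s -> Q a) /\
    forall m, Q m -> exists2 a, a \in s & forall i : 'I_n, (i < r)%N -> (a i <= m i)%N.
  have [s [sP sQ]] := main n (leqnn n) P; exists s; split=> // m /sQ[a as_ am].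
  by exists a => //; apply/mnm_lepP => i; apply: am.
elim: r le_rn => [|r IH] le_rn Q.
  have [[m Qm]|Q0] := pselect (exists m, Q m); last first.
    by exists [::]; split=> [a|m Qm]; [rewrite in_nil | case: Q0; exists m].
  exists [:: m]; split=> [a|a _]; first by rewrite inE => /eqP ->.
  by exists m; rewrite ?mem_head.
pose i0 := Ordinal le_rn.
have [s [sQ sP]] := IH (ltnW le_rn) Q.
have /choice[t tP] v := IH (ltnW le_rn) [set m | Q m /\ m i0 = v].
pose B := (\max_(a <- s) a i0).+1.
exists (s ++ flatten [seq t v | v <- iota 0 B]); split=> [a|m Qm].
  rewrite mem_cat => /orP[/sQ//|/flatten_mapP[v _ av]].
  by have [/(_ a av)[]] := tP v.
have split_lt (i : 'I_n) : (i < r.+1)%N -> i = i0 \/ (i < r)%N.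
  by rewrite ltnS leq_eqVlt => /predU1P[ir|]; [left; apply: val_inj | right].
have [mB|Bm] := ltnP (m i0) B.
  have [_ /(_ m (conj Qm erefl))[a ta am]] := tP (m i0).
  have [/(_ a ta)[_ a0] _] := tP (m i0).
  exists a; last by move=> i /split_lt[->|/am//]; rewrite a0.
  rewrite mem_cat; apply/orP; right; apply/flatten_mapP; exists (m i0) => //.
  by rewrite mem_iota.
have [a as_ am] := sP m Qm.
exists a; first by rewrite mem_cat as_.
move=> i /split_lt[->|/am//]; apply: leq_trans (ltnW Bm).
by rewrite (big_rem a) //= leq_maxl.
Qed.

(** A term order is a well-order, as it refines divisibility: the minimum of the
finitely many generators given by Dickson's lemma will do. *)
Lemma term_order_min (P : set 'X_{1..n}) :
  (exists m, P m) -> exists2 m, P m & forall m', P m' -> le m m'.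
Proof.
move=> [m Pm]; have [s [sP sQ]] := dickson P.
have [a as_ _] := sQ m Pm.
have [||| b bs bmin] := @seq_maximum _ (fun a b => le b a) a s _ _ _ as_.
- exact: le_refl.
- by move=> b c d cb bd; exact: le_trans bd cb.
- by move=> b c; exact: le_total.
exists b; first exact: sP.
by move=> m' /sQ[c cs cm]; apply: le_trans (bmin c cs) _; exact: term_order_dvd.
Qed.

End TermOrders.

(** * Algebraic dependence by counting monomials *)
Section Counting.
Import GRing.Theory.
Local Open Scope ring_scope.

Lemma exists_linear_relation (k : fieldType) (A T : finType) (B : {set T})
    (M : A -> T -> k) : (#|B| < #|A|)%N ->
  exists c : A -> k, (exists a, c a != 0) /\
    forall b, b \in B -> \sum_a c a * M a b = 0.
Proof.
move=> cardBA; pose Q := \matrix_(i < #|A|, j < #|B|) M (enum_val i) (enum_val j).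
have ker_neq0 : kermx Q != 0.
  rewrite -mxrank_eq0 mxrank_ker subn_eq0 -ltnNge.
  exact: leq_ltn_trans (rank_leq_col Q) cardBA.
have [u /sub_kermxP uQ u0] := rowV0Pn ker_neq0.
exists (fun a => u 0 (enum_rank a)); split.
  have /rV0Pn[i ui] := u0.
  by exists (enum_val i); rewrite enum_valK.
move=> b bB; have /rowP/(_ (enum_rank_in bB b)) := uQ.
rewrite !mxE => uQb; rewrite -[RHS]uQb (reindex (@enum_val A A)) /=; last first.
  by apply/onW_bij; exact: enum_val_bij.
by apply: eq_bigr => i _; rewrite enum_valK mxE enum_rankK_in.
Qed.

(** Points of a box all but [N] of whose coordinates are at most [e]: their number
grows with [T] no faster than [T ^ N]. *)
Lemma card_few_large (n T e N : nat) :
  (#|[set b : {ffun 'I_n -> 'I_T.+1} | (#|[set i | e < b i]| <= N)%N]%SET|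
    <= 2 ^ n * (e.+1 ^ n * T.+1 ^ N))%N.
Proof.
pose fam (A : {set 'I_n}) : {set {ffun 'I_n -> 'I_T.+1}} :=
  [set b | b \in family
    (fun i => if i \in A then predT else [pred x : 'I_T.+1 | (x <= e)%N])]%SET.
set X := [set b | _]%SET.
have subX : X \subset \bigcup_(A : {set 'I_n} | (#|A| <= N)%N) fam A.
  apply/fintype.subsetP => b; rewrite inE => bN; apply/finset.bigcupP.
  exists [set i | (e < b i)%N]%SET => //; rewrite inE; apply/familyP => i.
  by rewrite inE; case: ifP => // /negbT; rewrite -leqNgt inE.
apply: leq_trans (subset_leq_card subX) _.
have famN (A : {set 'I_n}) : (#|A| <= N)%N -> (#|fam A| <= e.+1 ^ n * T.+1 ^ N)%N.
  move=> AN; rewrite cardsE card_family foldrE big_map big_enum /=.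
  rewrite (bigID (mem A)) /= mulnC; apply: leq_mul.
    apply: (@leq_trans (\prod_(i | i \notin A) e.+1)%N); last first.
      rewrite prod_nat_const leq_pexp2l //.
      by apply: leq_trans (max_card _) _; rewrite card_ord.
    apply: leq_prod => i /negPf ->.
    rewrite -[leqRHS]card_ord -(card_in_imset (f := @inord e \o val)); last first.
      move=> x y; rewrite !inE /= => xe ye /(congr1 val).
      by rewrite /= !inordK // => /val_inj.
    exact: max_card.
  apply: (@leq_trans (\prod_(i in A) T.+1)%N); last first.
    by rewrite prod_nat_const leq_pexp2l.
  by apply: leq_prod => i ->; rewrite -[leqRHS]card_ord max_card.
apply: (@leq_trans (\sum_(A : {set 'I_n} | (#|A| <= N)%N) #|fam A|)).
  apply: (big_ind2 (fun (X : {set {ffun 'I_n -> 'I_T.+1}}) m => (#|X| <= m)%N)) => //.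
    by rewrite cards0.
  move=> X1 m1 X2 m2 X1m X2m; apply: leq_trans (leq_add X1m X2m).
  exact: leq_card_setU.
apply: leq_trans (leq_sum _ famN) _.
rewrite sum_nat_const leq_mul2r; apply/orP; right.
have <- : #|powerset [set: 'I_n]%SET| = (2 ^ n)%N.
  by rewrite card_powerset cardsT card_ord.
by apply/subset_leq_card/fintype.subsetP => A _; rewrite powersetT finset.in_setT.
Qed.

End Counting.

Section AlgebraicDependence.
Import GRing.Theory.
Local Open Scope ring_scope.
Variables (k : fieldType) (n : nat).
Variable J : set {mpoly k[n]}.
Hypothesis iJ : is_ideal J.
Implicit Types (a b m : 'X_{1..n}) (p q f g : {mpoly k[n]}).

(** [L] is a list of elements of [J], each with a monomial whose weight exceeds
that of its other monomials; reduction by [L] then lowers weights. *)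
Variables (W : 'I_n -> nat) (L : seq ({mpoly k[n]} * 'X_{1..n})).
Local Notation wdeg := (weighted_degree W).
Hypothesis LJ : forall fm, fm \in L -> J fm.1.
Hypothesis Llead : forall fm, fm \in L -> fm.2 \in msupp fm.1.
Hypothesis LW : forall fm, fm \in L -> forall m', m' \in msupp fm.1 ->
  m' != fm.2 -> (wdeg m' < wdeg fm.2)%N.

Definition degree_le T p := forall a, a \in msupp p -> (wdeg a <= T)%N.

Definition irreducible_monomial a := all (fun fm => ~~ (fm.2 <= a)%MM) L.

Definition has_normal_form T p := exists g, J (p - g) /\
  forall b, b \in msupp g -> irreducible_monomial b /\ (wdeg b <= T)%N.

Lemma wdegD a b : wdeg (a + b)%MM = (wdeg a + wdeg b)%N.
Proof. by rewrite -big_split; apply: eq_bigr => i _; rewrite mnmDE mulnDr. Qed.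

Lemma degree_leM T1 T2 p q :
  degree_le T1 p -> degree_le T2 q -> degree_le (T1 + T2) (p * q).
Proof.
move=> pT qT _ /msuppM_le/allpairsP[[a b] /= [/pT aT /qT bT ->]].
by rewrite wdegD leq_add.
Qed.

Lemma degree_leW T1 T2 p : (T1 <= T2)%N -> degree_le T1 p -> degree_le T2 p.
Proof. by move=> T12 pT a /pT aT; apply: leq_trans T12. Qed.

Lemma degree_le1 T : degree_le T 1.
Proof.
move=> a; rewrite -mpolyC1 msuppC; case: ifP => // _; rewrite inE => /eqP ->.
by rewrite /weighted_degree big1 // => i _; rewrite mnm0E muln0.
Qed.

Lemma degree_leX T p e : degree_le T p -> degree_le (e * T) (p ^+ e).
Proof.
move=> pT; elim: e => [|e IH]; first by rewrite expr0; exact: degree_le1.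
by rewrite exprS mulSn; exact: degree_leM.
Qed.

Lemma degree_le_prod (I : finType) T (F : I -> {mpoly k[n]}) :
  (forall i, degree_le T (F i)) -> degree_le (#|I| * T) (\prod_i F i).
Proof.
move=> FT; rewrite -sum_nat_const.
apply: (big_ind2 (fun p T => degree_le T p)) => //; first exact: degree_le1.
by move=> ? ? ? ?; exact: degree_leM.
Qed.

Lemma degree_le_ex p : exists T, degree_le T p.
Proof.
exists (\max_(a <- msupp p) wdeg a)%N => a ap.
by rewrite (big_rem a) //= leq_maxl.
Qed.

Lemma has_normal_formD T p q :
  has_normal_form T p -> has_normal_form T q -> has_normal_form T (p + q).
Proof.
move=> [g [Jg gP]] [h [Jh hP]]; exists (g + h); split.
  by rewrite opprD addrACA; exact: is_idealD.
by move=> b /msuppD_le; rewrite mem_cat => /orP[/gP|/hP].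
Qed.

Lemma has_normal_formZ T c p : has_normal_form T p -> has_normal_form T (c *: p).
Proof.
move=> [g [Jg gP]]; exists (c *: g); split.
  by rewrite -scalerBr -mul_mpolyC; exact: is_idealMl.
by move=> b /msuppZ_le/gP.
Qed.

Lemma has_normal_formW T T' p :
  (T <= T')%N -> has_normal_form T p -> has_normal_form T' p.
Proof.
move=> TT' [g [Jg gP]]; exists g; split=> // b /gP[bi bT]; split=> //.
exact: leq_trans TT'.
Qed.

Lemma has_normal_form_monomial_sum T p :
  (forall a, a \in msupp p -> has_normal_form T 'X_[a]) -> has_normal_form T p.
Proof.
move=> pT; rewrite [p]mpolyE big_seq; apply: big_ind.
- by exists 0; rewrite subrr; split; [exact: is_ideal0 | rewrite msupp0].
- by move=> ? ?; exact: has_normal_formD.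
- by move=> a ap; apply: has_normal_formZ; exact: pT.
Qed.

(** Division by [L]: a reducible monomial is replaced by monomials of smaller
weight, and weights are natural numbers. *)
Lemma degree_le_normal_form T p : degree_le T p -> has_normal_form T p.
Proof.
elim/ltn_ind: T p => T IH p pT; apply: has_normal_form_monomial_sum => a ap.
apply: (has_normal_formW (pT a ap)).
have [irr|/allPn[[f m] fmL]] := boolP (irreducible_monomial a).
  exists 'X_[a]; rewrite subrr; split; first exact: is_ideal0.
  by move=> b; rewrite msuppX inE => /eqP ->.
rewrite negbK /= => ma.
pose r := 'X_[a] - (f@_m)^-1 *: ('X_[a - m] * f).
have rlt b : b \in msupp r -> (wdeg b < wdeg a)%N.
  have fm0 : f@_m != 0 by rewrite -mcoeff_msupp; exact: (Llead fmL).
  have -> : r = 'X_[a - m] * ('X_[m] - (f@_m)^-1 *: f).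
    by rewrite mulrBr -mpolyXD submK // -scalerAr.
  move=> /msuppM_le/allpairsP[[c d] /= [+ dr ->]].
  rewrite msuppX inE => /eqP ->; rewrite -[a in ltnRHS](submK ma) !wdegD ltn_add2l.
  have dm : d != m.
    apply: contraTneq dr => ->; rewrite mcoeff_msupp mcoeffB mcoeffX mcoeffZ.
    by rewrite mulVf // eqxx subrr eqxx.
  apply: (LW fmL) => //; move: dr; rewrite mcoeff_msupp mcoeffB mcoeffX mcoeffZ.
  rewrite [m == d]eq_sym (negPf dm) sub0r oppr_eq0 mulf_eq0 => /norP[_].
  by rewrite -mcoeff_msupp.
have -> : 'X_[a] = r + (f@_m)^-1 *: ('X_[a - m] * f) by rewrite subrK.
apply: has_normal_formD; last first.
  exists 0; rewrite subr0; split; last by rewrite msupp0.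
  by rewrite -mul_mpolyC; do 2 apply: is_idealMl => //; exact: (LJ fmL).
have [a0|a_gt0] := posnP (wdeg a).
  have -> : r = 0.
    apply/eqP; rewrite -msupp_eq0; case: (msupp r) rlt => // b s /(_ b (mem_head _ _)).
    by rewrite a0.
  by exists 0; rewrite subrr; split; [exact: is_ideal0 | rewrite msupp0].
apply: (@has_normal_formW (wdeg a).-1); first exact: leq_pred.
apply: IH; first by apply: leq_trans (pT a ap); rewrite ltn_predL.
by move=> b /rlt; rewrite -[ltnRHS](prednK a_gt0) ltnS.
Qed.

End AlgebraicDependence.

Section DependenceTheorem.
Import GRing.Theory.
Local Open Scope ring_scope.
Variables (k : fieldType) (n : nat) (le : rel 'X_{1..n}).
Hypothesis ordle : term_order le.
Implicit Types (a b m : 'X_{1..n}) (p q f g : {mpoly k[n]}).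

Definition supported_in (A : {set 'I_n}) m := forall i, i \notin A -> m i = 0%N.

(** The monomials of exponent less than [t] in the [g i] number [t ^ r]. Modulo [J]
they are combinations of irreducible monomials of weight [O(t)]. If reduction is
by one polynomial for each set of [N + 1] variables, with leading monomial in
these variables, an irreducible monomial has at most [N] large exponents. So
there are only [O(t ^ N)] of them, and as [N < r] there is a linear relation. *)
Lemma algebraic_dependence (J : set {mpoly k[n]}) (N r : nat)
    (g : 'I_r -> {mpoly k[n]}) :
    is_ideal J ->
    (forall A : {set 'I_n}, #|A| = N.+1 -> exists f m,
      [/\ J f, initial_exponent le f m & supported_in A m]) ->
    (N < r)%N ->
  exists P : {mpoly k[r]}, P != 0 /\ J (mmap (@mpolyC n k) g P).
Proof.
move=> iJ leadA Nr.
have /choice[F FP] (A : {set 'I_n}) : exists fm : {mpoly k[n]} * 'X_{1..n},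
    #|A| = N.+1 -> [/\ J fm.1, initial_exponent le fm.1 fm.2 & supported_in A fm.2].
  have [/leadA[f [m fmP]]|cA] := pselect (#|A| = N.+1); first by exists (f, m).
  by exists (0, 0%MM).
pose L := [seq F A | A <- enum [pred A : {set 'I_n} | #|A| == N.+1]].
have LP fm : fm \in L -> exists2 A : {set 'I_n}, #|A| = N.+1 & fm = F A.
  by move=> /mapP[A]; rewrite mem_enum inE => /eqP cA ->; exists A.
have LJ fm : fm \in L -> J fm.1 by move=> /LP[A /FP[]+ _ _ ->].
have Llead fm : fm \in L -> fm.2 \in msupp fm.1 by move=> /LP[A /FP[_ [+ _] _ ->]].
(* The weights have to order only the monomials of these finitely many
   polynomials. *)
have [|W [W_gt0 WP]] := @term_order_weight n le ordle
  (flatten [seq [seq (fm.2, m') | m' <- msupp fm.1 & m' != fm.2] | fm <- L]).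
  move=> ab /flatten_mapP[fm /LP[A /FP[_ [_ lead] _] ->] /mapP[m' + ->]] /=.
  by rewrite mem_filter => /andP[/eqP m'm /lead].
have LW fm : fm \in L -> forall m', m' \in msupp fm.1 -> m' != fm.2 ->
    (weighted_degree W m' < weighted_degree W fm.2)%N.
  move=> fmL m' m'f m'm; apply: (WP (fm.2, m')).
  apply/flatten_mapP; exists fm => //; apply/mapP; exists m' => //.
  by rewrite mem_filter m'm.
have [D gD] : exists D, forall i, degree_le W D (g i).
  have /choice[d dP] i := degree_le_ex W (g i).
  by exists (\max_i d i)%N => i; apply: degree_leW (dP i); exact: leq_bigmax.
pose e := (\max_(fm <- L) \max_i fm.2 i)%N.
have eP fm i : fm \in L -> (fm.2 i <= e)%N.
  move=> fmL; rewrite /e (big_rem fm) //=; apply: leq_trans (leq_maxl _ _).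
  exact: leq_bigmax.
(* [T] bounds the weights; [C * t ^ N] bounds the number of irreducible monomials,
   because [T.+1 <= (D * r).+1 * t]. *)
pose C := (2 ^ n * e.+1 ^ n * (D * r).+1 ^ N)%N.
pose t := C.+1.
pose T := (r * (t * D))%N.
pose mono (b : {ffun 'I_n -> 'I_T.+1}) := [multinom (b i : nat) | i < n].
pose B := [set b | irreducible_monomial L (mono b)]%SET.
have cardB : (#|B| < #|{ffun 'I_r -> 'I_t}|)%N.
  rewrite card_ffun !card_ord.
  apply: (@leq_ltn_trans (2 ^ n * (e.+1 ^ n * T.+1 ^ N))%N).
    apply: leq_trans (card_few_large n T e N); apply/subset_leq_card/fintype.subsetP => b.
    rewrite !inE => irr; rewrite leqNgt; apply/negP => /card_geqP[s [us ss sb]].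
    pose A := [set i in s]%SET.
    have cA : #|A| = N.+1 by rewrite cardsE; apply/eqP; rewrite -ss; apply/eqP/card_uniqP.
    have AL : F A \in L by apply: map_f; rewrite mem_enum inE cA.
    move/allP: irr => /(_ _ AL)/negP; apply; apply/mnm_lepP => i; rewrite mnmE.
    have [iA|iA] := boolP (i \in A); last by have [_ _ ->] := FP A cA.
    apply: leq_trans (eP _ i AL) _; apply: ltnW.
    by move: iA; rewrite inE => /sb; rewrite inE.
  have TC : (T.+1 <= (D * r).+1 * t)%N by rewrite /T /t; nia.
  apply: (@leq_ltn_trans (C * t ^ N)).
    rewrite /C -!mulnA; do 2 apply: leq_mul => //; rewrite -expnMn.
    by case: (posnP N) => [->|N_gt0]; rewrite ?expn0 ?leq_exp2r.
  apply: (@leq_trans (t ^ N.+1)); first by rewrite expnS ltn_mul2r expn_gt0 /= ltnSn.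
  by rewrite leq_pexp2l.
pose prodg (c : {ffun 'I_r -> 'I_t}) := \prod_i g i ^+ c i.
have prodgT c : degree_le W T (prodg c).
  rewrite /T -[r in (r * _)%N]card_ord; apply: degree_le_prod => i.
  apply: degree_leW (degree_leX (gD i)).
  by rewrite leq_mul2r (ltnW (ltn_ord _)) orbT.
have /choice[h hP] c := degree_le_normal_form iJ LJ Llead LW (prodgT c).
have [u [[c0 uc0] uP]] := exists_linear_relation
  (fun c (b : {ffun 'I_n -> 'I_T.+1}) => (h c)@_(mono b)) cardB.
pose exps (c : {ffun 'I_r -> 'I_t}) := [multinom (c i : nat) | i < r].
have exps_inj : injective exps.
  move=> c d /mnmP cd; apply/ffunP => i; apply: val_inj.
  by have := cd i; rewrite !mnmE.
exists (\sum_c u c *: 'X_[exps c]); split.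
  apply/eqP => /mpolyP/(_ (exps c0)); rewrite mcoeff0 raddf_sum /= (bigD1 c0) //=.
  rewrite mcoeffZ mcoeffX eqxx mulr1 big1 ?addr0 => [uc|c cc0].
    by rewrite uc eqxx in uc0.
  by rewrite mcoeffZ mcoeffX (inj_eq exps_inj) (negPf cc0) mulr0.
have sum0 : \sum_c u c *: h c = 0.
  apply/mpolyP => b; rewrite mcoeff0 raddf_sum /=.
  have [bh|nobh] := pselect (exists c, b \in msupp (h c)); last first.
    rewrite big1 // => c _; rewrite mcoeffZ memN_msupp_eq0 ?mulr0 //.
    by apply/negP => bc; apply: nobh; exists c.
  have [c bc] := bh; have [_ /(_ b bc)[irr bT]] := hP c.
  have bi i : (b i < T.+1)%N.
    rewrite ltnS; apply: leq_trans bT; rewrite /weighted_degree (bigD1 i) //=.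
    by apply: leq_trans (leq_addr _ _); rewrite leq_pmull.
  pose b' : {ffun 'I_n -> 'I_T.+1} := [ffun i => Ordinal (bi i)].
  have bb' : mono b' = b by apply/mnmP => i; rewrite mnmE ffunE.
  rewrite -[RHS](uP b') ?inE ?bb' //.
  by apply: eq_bigr => d _; rewrite mcoeffZ.
have -> : mmap (@mpolyC n k) g (\sum_c u c *: 'X_[exps c]) =
    \sum_c u c *: (prodg c - h c).
  rewrite raddf_sum /=; under [RHS]eq_bigr do rewrite scalerBr.
  rewrite sumrB sum0 subr0; apply: eq_bigr => c _.
  rewrite mmapZ mmapX mul_mpolyC /prodg /mmap1.
  by congr (_ *: _); apply: eq_bigr => i _; rewrite mnmE.
apply: ideal_sumr => // c _; rewrite -mul_mpolyC; apply: is_idealMl => //.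
by have [] := hP c.
Qed.

End DependenceTheorem.

(** * Substitutions and extensions of primes to polynomial rings *)
Section PolynomialMorphisms.
Import GRing.Theory.
Local Open Scope ring_scope.

(** A morphism is determined by its values on constants and variables. With
[eq_mmap] this is the extensionality principle for all substitutions below. *)
Lemma rmorph_mmapE (R : nzRingType) n (A : comNzRingType)
    (F : {rmorphism {mpoly R[n]} -> A}) f :
  F f = mmap (F \o @mpolyC n R) (fun i => F 'X_i) f.
Proof.
rewrite [in LHS](mpolyE f) raddf_sum; apply: eq_bigr => m _.
rewrite /= -mul_mpolyC rmorphM; congr (_ * _).
by rewrite mpolyXE_id rmorph_prod; apply: eq_bigr => i _; rewrite rmorphXn.
Qed.

Lemma eq_mmap (R : nzRingType) n (A : nzRingType) (c c' : R -> A) (h h' : 'I_n -> A) f :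
    (forall x, c x = c' x) ->
    (forall m i, m \in msupp f -> m i != 0%N -> h i = h' i) ->
  mmap c h f = mmap c' h' f.
Proof.
move=> cc' hh'; apply: eq_big_seq => m mf; rewrite cc'; congr (_ * _).
apply: eq_bigr => i _; case: (eqVneq (m i) 0%N) => [->|mi]; first by rewrite !expr0.
by rewrite (hh' m).
Qed.

Lemma mmap_id (R : comNzRingType) n (f : {mpoly R[n]}) :
  mmap (@mpolyC n R) (fun i => 'X_i) f = f.
Proof. exact/esym/(rmorph_mmapE (@idfun {mpoly R[n]})). Qed.

(** Evaluation of the univariate indeterminate at the last variable is a left inverse. *)
Lemma muni_inj (R : comNzRingType) n : injective (@muni n R).
Proof.
pose back : {poly {mpoly R[n]}} -> {mpoly R[n.+1]} :=
  horner_eval 'X_ord_max \o map_poly (@mwiden n R).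
apply: (@can_inj _ _ _ back) => p.
rewrite -[LHS]/((back \o @muni n R) p) rmorph_mmapE -[RHS]mmap_id.
apply: eq_mmap => [c|m i _ _].
  by rewrite /= muniC map_polyC /= mwidenC /horner_eval hornerC.
rewrite /= /muni mmapX mmap1U; case: splitP => [j|j] ij.
  rewrite map_polyC /horner_eval /= hornerC mwidenX mnmwiden1.
  by congr 'X_(_); apply: val_inj.
rewrite map_polyX /horner_eval hornerX; congr 'X_(_); apply: val_inj => /=.
by move: ij; rewrite ord1 /= addn0.
Qed.

End PolynomialMorphisms.

Section PrimeExtension.
Import GRing.Theory.
Local Open Scope ring_scope.

Lemma prime_preimage (R S : comNzRingType) (F : {rmorphism R -> S}) (q : set S) :
  is_prime q -> is_prime (F @^-1` q).
Proof.
move=> [iq q1 qM]; split; first split.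
- by rewrite /= rmorph0; exact: is_ideal0.
- by move=> f g qf qg; rewrite /= rmorphD; exact: is_idealD.
- by move=> a f qf; rewrite /= rmorphM; exact: is_idealMl.
- by rewrite /is_proper /= rmorph1.
- by move=> f g; rewrite /= rmorphM; exact: qM.
Qed.

Variables (R : comNzRingType) (n : nat).
Implicit Types q : set R.

Definition mpoly_extension q : set {mpoly R[n]} := [set f | forall a, q f@_a].

Lemma is_ideal_mpoly_extension q : is_ideal q -> is_ideal (mpoly_extension q).
Proof.
move=> iq; split=> [a|f g qf qg a|h f qf a].
- by rewrite mcoeff0; exact: is_ideal0.
- by rewrite mcoeffD; exact: is_idealD (qf a) (qg a).
- by rewrite mcoeffM; apply: ideal_sumr => // ? _; exact: is_idealMl.
Qed.

Lemma mpoly_extensionC q c : is_ideal q -> q c -> mpoly_extension q c%:MP.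
Proof. by move=> iq qc a; rewrite mcoeffC; exact: is_idealMr. Qed.

(** Discarding the coefficients that lie in [q] changes [f] and [g] only modulo
the extension; if something is left of both, the product of their leading
coefficients is a coefficient of [f * g] modulo [q], and it is not in [q]. *)
Lemma is_prime_mpoly_extension q : is_prime q -> is_prime (mpoly_extension q).
Proof.
move=> qP; have [iq q1 qM] := qP; have iqX := is_ideal_mpoly_extension iq.
split=> //; first by move=> /(_ 0%MM); rewrite mcoeff1 eqxx.
have trunc f : exists g, mpoly_extension q (f - g) /\ forall a, q g@_a -> g@_a = 0.
  pose E a := if `[< q f@_a >] then 0 else f@_a.
  pose g := \sum_(a <- msupp f) E a *: 'X_[a].
  have gE b : g@_b = E b.
    rewrite /g raddf_sum /=; have [bf|bf] := boolP (b \in msupp f).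
      rewrite (bigD1_seq b) //= ?msupp_uniq // big1 => [|a ab].
        by rewrite mcoeffZ mcoeffX eqxx mulr1 addr0.
      by rewrite mcoeffZ mcoeffX (negPf ab) mulr0.
    rewrite big1_seq => [|a /= af]; last first.
      rewrite mcoeffZ mcoeffX; case: eqVneq => [ab|]; last by rewrite mulr0.
      by rewrite -ab af in bf.
    by rewrite /E (memN_msupp_eq0 bf); case: ifP.
  exists g; split=> a; rewrite ?mcoeffB gE /E; case: asboolP => //.
    by rewrite subr0.
  by rewrite subrr => _; exact: is_ideal0.
move=> f g qfg; have [f1 [ff1 f1P]] := trunc f; have [g1 [gg1 g1P]] := trunc g.
have qf1g1 : mpoly_extension q (f1 * g1).
  have -> : f1 * g1 = f * g - ((f - f1) * g + f1 * (g - g1)).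
    by rewrite mulrBl mulrBr addrA subrK opprB addrC subrK.
  apply: (is_idealB iqX) => //; apply: (is_idealD iqX).
    exact: (is_idealMr _ iqX).
  exact: (is_idealMl _ iqX).
have := qf1g1 (mlead f1 + mlead g1)%MM; rewrite mleadcM => /qM[/f1P|/g1P] /eqP;
  rewrite mleadc_eq0 => /eqP z; [left|right].
- by move: ff1; rewrite z subr0.
- by move: gg1; rewrite z subr0.
Qed.

End PrimeExtension.

(** * Independent sets of variables and lower bounds for heights *)
Section Height.
Import GRing.Theory.
Local Open Scope ring_scope.
Variables (k : fieldType) (n : nat).
Local Notation S := {mpoly k[n]}.
Implicit Types (J q : set S) (f g : S) (U : {set 'I_n}).

Definition poly_in U f := forall m, m \in msupp f -> supported_in U m.

Definition independent J U := forall f, J f -> poly_in U f -> f = 0.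

Lemma prime_constant_eq0 q (c : k) : is_prime q -> q c%:MP -> c = 0.
Proof.
move=> [iq q1 _] qc; apply/eqP; apply: contrapT => /negP c0; apply: q1.
by rewrite -mpolyC1 -(mulVf c0) mpolyCM; exact: is_idealMl.
Qed.

(** The ideals generated by the contractions of [q] to the subrings
[k[x_0, ..., x_(i-1)]] form an increasing sequence of primes from [0] to [q]. *)
Section PartialGenericPoint.
Variables (q : set S) (qP : is_prime q).

(** The variables [x_j] with [j < i] are kept as coefficients and the others become
indeterminates. *)
Definition free_above (i : nat) : S -> {mpoly S[n]} :=
  mmap (@mpolyC n S \o @mpolyC n k)
    (fun j : 'I_n => if (j < i)%N then ('X_j)%:MP else 'X_j).

HB.instance Definition _ i := GRing.RMorphism.on (free_above i).

(** The extension to the whole ring of the contraction of [q] to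
[k[x_0, ..., x_(i-1)]], presented as the preimage of a prime to make it visibly
prime. *)
Definition truncation i : set S := free_above i @^-1` mpoly_extension q.

Lemma is_prime_truncation i : is_prime (truncation i).
Proof. exact/prime_preimage/is_prime_mpoly_extension. Qed.

Lemma truncation_last : truncation n = q.
Proof.
have iq := prime_idealW qP.
have free_above_all f : free_above n f = f%:MP_[n].
  apply: etrans (esym (rmorph_mmapE (@mpolyC n S) f)).
  by apply: eq_mmap => // m j _ _; rewrite ltn_ord.
apply/seteqP; split=> f; rewrite /truncation /= free_above_all; last first.
  exact: mpoly_extensionC.
by move=> /(_ 0%MM); rewrite mcoeffC eqxx mulr1.
Qed.

(** Giving the indeterminate [i] the value [x_i] turns [free_above i] into [free_above i.+1]. *)
Lemma truncation_mono i : truncation i `<=` truncation i.+1.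
Proof.
pose ev : {mpoly S[n]} -> {mpoly S[n]} :=
  mmap (@mpolyC n S) (fun j : 'I_n => if (j < i.+1)%N then ('X_j)%:MP else 'X_j).
have evE f : free_above i.+1 f = ev (free_above i f).
  rewrite -[RHS]/((ev \o free_above i) f) [RHS]rmorph_mmapE.
  apply: eq_mmap => [c|m j _ _]; first by rewrite /= /free_above mmapC /= /ev mmapC.
  rewrite /= /free_above mmapX mmap1U; case: ifP => [ji|ji]; case: ifP => [ji'|ji'].
  - by rewrite /ev mmapC.
  - by rewrite /ev mmapX mmap1U ji.
  - by rewrite (leqW ji') in ji.
  - by rewrite /ev mmapX mmap1U ji.
have iqX := is_ideal_mpoly_extension n (prime_idealW qP).
move=> f qf; rewrite /truncation /= evE /ev /mmap; apply: (ideal_sumr _ iqX) => m _.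
by apply: (is_idealMr _ iqX); apply: mpoly_extensionC (prime_idealW qP) _; exact: qf.
Qed.

Lemma truncation_first f : truncation 0 f -> f = 0.
Proof.
move=> qf; apply/mpolyP => a; rewrite mcoeff0.
apply: (prime_constant_eq0 qP); have := qf a.
have -> : free_above 0 f = map_mpoly (@mpolyC n k) f by apply: eq_mmap.
by rewrite mcoeff_map_mpoly.
Qed.

Definition stays (i : nat) := `[< truncation i.+1 `<=` truncation i >].

Lemma truncation_chain i :
  prime_chain (\sum_(0 <= j < i) ~~ stays j) (truncation i).
Proof.
elim: i => [|i IH]; first by rewrite big_geq //; exact/prime_chain0/is_prime_truncation.
rewrite (big_nat_recr _ _ _ (leq0n i)) /=.
have [st|nst] := boolP (stays i).
  rewrite addn0; apply: prime_chain_sub IH _ (@truncation_mono i).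
  exact: is_prime_truncation.
rewrite addn1; apply: prime_chainS IH (is_prime_truncation _) _.
split; first exact: truncation_mono.
by move=> /asboolP; exact/negP.
Qed.

(** [U] consists of the steps at which the truncations of [q] do not grow, so that
the other steps give a chain of length [n - #|U|]. An element of [q] in the
variables of [U] descends from each truncation to the previous one: at a step
in [U] the two are equal, and at another step the variable does not occur. *)
Lemma prime_independent_set :
  exists U, independent q U /\ enat_le (Fin (n - #|U|)) (prime_height q).
Proof.
pose U := [set i : 'I_n | stays i]%SET; exists U; split; last first.
  have := truncation_chain n; rewrite truncation_last big_mkord.
  suff -> : (\sum_(i < n) ~~ stays i = n - #|U|)%N by exact: prime_chain_le.
  have -> : (n - #|U|)%N = #|finset.setC U| by rewrite [RHS]cardsCs finset.setCK card_ord.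
  rewrite -sum1_card [RHS]big_mkcond; apply: eq_bigr => i _; rewrite !inE.
  by case: stays.
move=> f qf fU; apply: truncation_first.
suff main i : (i <= n)%N -> truncation i f -> truncation 0 f.
  by apply: (main n) => //; rewrite truncation_last.
elim: i => [_|i IH lt_in qif]; first exact: id.
apply: (IH (ltnW lt_in)).
have [/asboolP st|nst] := boolP (stays i); first exact: st.
move: qif; rewrite /truncation /=.
suff -> : free_above i.+1 f = free_above i f by [].
apply: eq_mmap => // m j mf mj; rewrite ltnS leq_eqVlt.
case: eqP => //= ji; case/negP: mj; apply/eqP/fU => //.
by rewrite inE ji.
Qed.

End PartialGenericPoint.

End Height.

(** * Independent sets of variables and upper bounds for heights *)
Section HeightUpperBound.
Import Order.TTheory GRing.Theory.
Local Open Scope ring_scope.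
Variables (k : fieldType) (n : nat).
Local Notation S := {mpoly k[n]}.
Implicit Types (J q : set S) (f g : S) (U : {set 'I_n}).

Definition algebraically_independent q r (g : 'I_r -> S) :=
  forall P : {mpoly k[r]}, q (mmap (@mpolyC n k) g P) -> P = 0.

Lemma supported_inD U a b :
  supported_in U a -> supported_in U b -> supported_in U (a + b)%MM.
Proof. by move=> aU bU i iU; rewrite mnmDE aU ?bU. Qed.

Lemma poly_inM U f g : poly_in U f -> poly_in U g -> poly_in U (f * g).
Proof.
move=> fU gU _ /msuppM_le/allpairsP[[a b] /= [/fU aU /gU bU ->]].
exact: supported_inD.
Qed.

Lemma poly_inC U c : poly_in U (c%:MP : S).
Proof.
by move=> m; rewrite msuppC; case: ifP => // _; rewrite inE => /eqP -> i _; rewrite mnm0E.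
Qed.

Lemma poly_inX U i : i \in U -> poly_in U ('X_i : S).
Proof.
move=> iU m; rewrite msuppX inE => /eqP -> j; rewrite mnm1E.
by case: eqVneq => // <-; rewrite iU.
Qed.

Lemma poly_in_mmap U r (g : 'I_r -> S) P :
  (forall i, poly_in U (g i)) -> poly_in U (mmap (@mpolyC n k) g P).
Proof.
move=> gU; rewrite /mmap; apply: (big_ind (poly_in U)).
- by rewrite -mpolyC0; exact: poly_inC.
- by move=> f h fU hU m /msuppD_le; rewrite mem_cat => /orP[/fU|/hU].
move=> m _; apply: poly_inM; first exact: poly_inC.
apply: (big_ind (poly_in U)); rewrite -?mpolyC1; first exact: poly_inC.
  exact: poly_inM.
move=> i _; elim: (m i) => [|e IH]; first by rewrite expr0 -mpolyC1; exact: poly_inC.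
by rewrite exprS; apply: poly_inM.
Qed.

Definition variables_of U (i : 'I_#|U|) : S := 'X_(enum_val i).

(** A substitution of distinct variables is injective: sending the other variables
to [0] gives a left inverse. *)
Lemma independent_variables J U :
  independent J U -> algebraically_independent J (@variables_of U).
Proof.
move=> indU P JP.
have P0 : mmap (@mpolyC n k) (@variables_of U) P = 0.
  by apply: indU JP _; apply: poly_in_mmap => i; apply: poly_inX; exact: enum_valP.
pose back : S -> {mpoly k[#|U|]} := mmap (@mpolyC #|U| k)
  (fun j => if [pick i : 'I_#|U| | enum_val i == j] is Some i then 'X_i else 0).
suff -> : P = back (mmap (@mpolyC n k) (@variables_of U) P) by rewrite P0 /back rmorph0.
rewrite -[RHS]/((back \o mmap (@mpolyC n k) (@variables_of U)) P) rmorph_mmapE.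
rewrite -[LHS]mmap_id; apply: eq_mmap => [c|m i _ _] /=; first by rewrite !(mmapC, mmapX).
rewrite mmapX mmap1U /back mmapX mmap1U.
case: pickP => [j /eqP/enum_val_inj -> //|/(_ i)].
by rewrite eqxx.
Qed.

(** [algebraic_dependence] for the zero ideal. No set of variables has [n + 1]
elements, so the hypothesis on leading monomials is vacuous; the count is applied
with the degree order. *)
Lemma algebraically_independent_le q r (g : 'I_r -> S) :
  is_ideal q -> algebraically_independent q g -> (r <= n)%N.
Proof.
move=> iq indg; rewrite leqNgt; apply/negP => nr.
pose le (a b : 'X_{1..n}) := (a <= b)%O.
have ordle : term_order le.
  split; last split.
  - by split; [exact: lexx | exact: le_anti | exact: le_trans | exact: le_total].
  - exact: le0m.
  - by move=> m m1 m2; rewrite /le lemc_add2l.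
have [||//|P [P0 PJ]] := @algebraic_dependence k n le ordle [set 0] n r g.
- by split=> [//|f h /= -> ->|a f /= ->]; rewrite ?addr0 ?mulr0.
- move=> A cA; have := max_card A; rewrite cA card_ord.
  by rewrite ltnn.
- by move/eqP: P0; apply; apply: indg; rewrite PJ; exact: is_ideal0.
Qed.

(** The last entry is chosen as in [muni], which singles out the last variable. *)
Definition extend_tuple r (g : 'I_r -> S) (f : S) (i : 'I_r.+1) : S :=
  match split (cast_ord (esym (addn1 r)) i) with inl j => g j | inr _ => f end.

(** A relation modulo [q0] is a univariate polynomial [Q] in [f] whose coefficients
are polynomials in the [g i]. Modulo [q1] it reduces to its constant
coefficient, which therefore vanishes; as [q0] is prime and does not contain
[f], the relation can be divided by [f], and so on. *)
Lemma algebraically_independentS q0 q1 r (g : 'I_r -> S) f :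
    is_prime q0 -> is_ideal q1 -> q0 `<=` q1 -> q1 f -> ~ q0 f ->
  algebraically_independent q1 g -> algebraically_independent q0 (extend_tuple g f).
Proof.
move=> q0P iq1 q01 q1f nq0f indg P.
pose G : {mpoly k[r]} -> S := mmap (@mpolyC n k) g.
have -> : mmap (@mpolyC n k) (extend_tuple g f) P = (map_poly G (muni P)).[f].
  rewrite -[RHS]/((horner_eval f \o map_poly G \o @muni r k) P) [RHS]rmorph_mmapE.
  apply: eq_mmap => [c|m i _ _] /=.
    by rewrite muniC map_polyC /horner_eval hornerC /= /G mmapC.
  rewrite /muni mmapX mmap1U /extend_tuple; case: splitP => j _.
    by rewrite map_polyC /horner_eval hornerC /= /G mmapX mmap1U.
  by rewrite map_polyX /horner_eval hornerX.
have [_ _ q0M] := q0P; have iq0 := prime_idealW q0P.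
suff main Q : q0 (map_poly G Q).[f] -> Q = 0.
  by move=> /main P0; apply: (@muni_inj k r); rewrite P0 muni0.
elim/poly_ind: Q => [//|Q c IH].
rewrite rmorphD rmorphM /= map_polyX map_polyC hornerD hornerMX hornerC.
rewrite -[X in _ + X]/(G c) => q0Q.
have c0 : c = 0.
  apply: indg; rewrite -/(G c).
  rewrite -[G c](addKr ((map_poly G Q).[f] * f)); apply: is_idealD => //.
    by apply: is_idealN => //; exact: is_idealMl.
  exact: q01.
have G0 : G 0 = 0 by exact: rmorph0.
move: q0Q; rewrite c0 G0 polyC0 !addr0 => /q0M[/IH ->|//].
by rewrite mul0r.
Qed.

(** Descending along the chain, choose in each member an element outside the
previous one. These elements together with the [g i] are algebraically
independent. *)
Lemma prime_chain_independent_le c q r (g : 'I_r -> S) :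
  prime_chain c q -> algebraically_independent q g -> (c + r <= n)%N.
Proof.
elim: c q r g => [|c IH] q r g [C [CP CS Cq]] indg.
  rewrite add0n; apply: algebraically_independent_le indg.
  by rewrite -Cq; exact/prime_idealW/CP.
have [Cc /existsNP[f /not_implyP[Cf nCf]]] := CS c (ltnSn c).
rewrite Cq in Cc Cf.
rewrite addSnnS; apply: (IH (C c) r.+1 (extend_tuple g f)).
  by exists C; split=> // i ic; [apply: CP | apply: CS]; exact: leqW.
apply: algebraically_independentS indg => //; first by apply: CP.
by rewrite -Cq; exact/prime_idealW/CP.
Qed.

Lemma prime_height_independent q U :
  independent q U -> enat_le (prime_height q) (Fin (n - #|U|)).
Proof.
move=> /independent_variables indU; apply: prime_height_le => c qc /=.
by have := leq_sub2r #|U| (prime_chain_independent_le qc indU); rewrite addnK.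
Qed.

Lemma prime_height_finite q : is_prime q -> exists d, prime_height q = Fin d.
Proof.
move=> qP; have := @prime_height_independent q finset.set0.
case: (prime_height q) => [d|] H; first by exists d.
suff /H : independent q finset.set0 by [].
move=> f qf f0.
have fE : f = (f@_0%MM)%:MP.
  apply/mpolyP => a; rewrite mcoeffC; case: eqVneq => [->|a0]; rewrite ?mulr1 ?mulr0 //.
  apply: memN_msupp_eq0; apply/negP => /f0 af; case/eqP: a0.
  by apply/mnmP => i; rewrite mnm0E af ?inE.
by rewrite fE in qf *; rewrite (prime_constant_eq0 qP qf) mpolyC0.
Qed.

(** Heights are finite, so a chain of length [prime_height q] exists and can be
prolonged by [q']. *)
Lemma prime_height_lt q q' : is_prime q -> is_prime q' -> q `<` q' ->
  enat_le (enat_succ (prime_height q)) (prime_height q').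
Proof.
move=> qP q'P qq'; have [d qd] := prime_height_finite qP; rewrite qd.
have [c cd qc] : exists2 c, (d <= c)%N & prime_chain c q.
  apply: contrapT => no.
  have : enat_le (prime_height q) (Fin d.-1).
    apply: prime_height_le => c qc /=; rewrite leqNgt; apply/negP => dc.
    by apply: no; exists c => //; lia.
  rewrite qd /= => d1; have d0 : d = 0%N by lia.
  by apply: no; exists 0%N; rewrite ?d0 //; exact: prime_chain0.
apply: enat_le_trans (prime_chain_le (prime_chainS qc q'P qq')).
by rewrite /= ltnS.
Qed.

(** The nonzero polynomials in the variables of [U] form a multiplicative set
avoiding [J]; a prime that contains [J] and avoids it has [U] as an independent
set too. *)
Lemma ideal_height_independent J U : is_ideal J ->
  independent J U -> enat_le (ideal_height J) (Fin (n - #|U|)).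
Proof.
move=> iJ indU.
have [||q [qP Jq qW]] := @prime_avoiding _ J [set f | poly_in U f /\ f <> 0] iJ.
- split; first by rewrite -mpolyC1; split; [exact: poly_inC | exact/eqP/oner_neq0].
  move=> f g [fU f0] [gU g0]; split; first exact: poly_inM.
  by apply/eqP; rewrite mulf_eq0; apply/norP; split; exact/eqP.
- by move=> f [Jf [fU f0]]; apply: f0; exact: indU.
apply: enat_le_trans (_ : enat_le (prime_height q) _).
  by apply: enat_inf_lb; exists q.
apply: prime_height_independent => f qf fU; apply: contrapT => f0.
by apply: (qW f).
Qed.

End HeightUpperBound.

(** * Initial ideals *)
Section InitialIdeals.
Import GRing.Theory.
Local Open Scope ring_scope.
Variables (k : fieldType) (n : nat) (le : rel 'X_{1..n}).
Hypothesis ordle : term_order le.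
Local Notation S := {mpoly k[n]}.
Local Notation initial := (initial_ideal le).
Implicit Types (A B J K q : set S) (f g h : S) (a b m : 'X_{1..n}) (U : {set 'I_n}).

Let le_anti : antisymmetric le. Proof. by case: ordle => -[]. Qed.
Let le_trans : transitive le. Proof. by case: ordle => -[]. Qed.

Definition lead J m := exists2 f, J f & initial_exponent le f m.

Lemma initial_exponent_ex f : f != 0 -> exists m, initial_exponent le f m.
Proof.
move=> f0; have : mlead f \in msupp f by apply: mlead_supp.
by move=> /(term_order_seq_max ordle)[m mf mP]; exists m.
Qed.

(** Split each factor into its leading term and a tail. The products that involve
a tail do not contain the monomial [a + b], by strictness of the order. *)
Lemma initial_exponentM f g a b : initial_exponent le f a -> initial_exponent le g b ->
  initial_exponent le (f * g) (a + b)%MM.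
Proof.
move=> [af fa] [bg gb]; split; last first.
  move=> _ /msuppM_le/allpairsP[[c d] /= [/fa ca /gb db ->]].
  exact: term_order_add.
pose tail (p : S) m : S := p - p@_m *: 'X_[m].
have tailP p m m' : m' \in msupp (tail p m) -> m' \in msupp p /\ m' <> m.
  rewrite !mcoeff_msupp /tail mcoeffB mcoeffZ mcoeffX.
  have [->|mm'] := eqVneq m m'; first by rewrite mulr1 subrr eqxx.
  by rewrite mulr0 subr0 => ->; split=> // /esym/eqP; apply/negP.
have notin (p r : S) :
    (forall m m', m \in msupp p -> m' \in msupp r -> (a + b)%MM <> (m + m')%MM) ->
  (p * r)@_(a + b) = 0.
  move=> H; apply: memN_msupp_eq0; apply/negP => /msuppM_le/allpairsP[[m m'] /= [mp mr]].
  exact: H.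
have -> : f * g = (f@_a *: 'X_[a]) * (g@_b *: 'X_[b]) +
    (f@_a *: 'X_[a]) * tail g b + tail f a * g.
  by rewrite -mulrDr addrC [_ + tail g b]addrC subrK -mulrDl subrK.
rewrite mcoeff_msupp !mcoeffD (notin (f@_a *: 'X_[a]) (tail g b)) //; last first.
  move=> m m' /msuppZ_le; rewrite msuppX inE => /eqP -> /tailP[/gb m'b nm'b] e.
  by apply: nm'b; move: e => /addmI.
rewrite (notin (tail f a) g) //; last first.
  move=> m m' /tailP[/fa ma nma] /gb m'b e; apply: nma.
  by have [] := term_order_add_eq ordle ma m'b (esym e).
rewrite !addr0 -scalerAl -scalerAr -mpolyXD !mcoeffZ mcoeffX eqxx mulr1.
by rewrite mulf_neq0 // -mcoeff_msupp.
Qed.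

Lemma initial_exponent_cancel f g m :
    initial_exponent le f m -> initial_exponent le g m -> exists c,
  forall m', m' \in msupp (f - c *: g) -> le m' m /\ m' <> m.
Proof.
move=> [mf fm] [mg gm]; exists (f@_m / g@_m) => m' m'h; split.
  have := msuppB_le m'h; rewrite mem_cat => /orP[/fm//|/msuppZ_le/gm//].
move=> m'm; move: m'h; rewrite mcoeff_msupp m'm mcoeffB mcoeffZ divfK ?subrr ?eqxx //.
by rewrite -mcoeff_msupp.
Qed.

Lemma lead_addr J a b : is_ideal J -> lead J a -> lead J (b + a)%MM.
Proof.
move=> iJ [f Jf fa]; exists ('X_[b] * f); first exact: is_idealMl.
apply: initial_exponentM => //; split=> [|m]; rewrite msuppX ?mem_head // inE => /eqP ->.
by case: ordle => -[].
Qed.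

Lemma leadD A B a b : is_ideal A -> is_ideal B -> lead A a -> lead B b ->
  lead (A `&` B) (a + b)%MM.
Proof.
move=> iA iB [f Af fa] [g Bg gb]; exists (f * g); last exact: initial_exponentM.
by split; [exact: is_idealMr | exact: is_idealMl].
Qed.

(** The exponents in [lead J] are already closed under addition of arbitrary
exponents, so the polynomials supported on them form an ideal. Membership of a
monomial in the initial ideal thus yields an element of [J] led by it. *)
Lemma initial_idealE J : is_ideal J ->
  initial J = [set f | forall m, m \in msupp f -> lead J m].
Proof.
move=> iJ; have iL : is_ideal [set f : S | forall m, m \in msupp f -> lead J m].
  split=> [m|f g fL gL m|h f fL m].
  - by rewrite msupp0.
  - by move=> /msuppD_le; rewrite mem_cat => /orP[/fL|/gL].
  - by move=> /msuppM_le/allpairsP[[a b] /= [_ /fL bL ->]]; exact: lead_addr.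
apply/seteqP; split.
  apply: smallest_sub => // _ [f [m [Jf fm ->]]] m'.
  by rewrite msuppX inE => /eqP ->; exists f.
have iI : is_ideal (initial J) by exact: is_ideal_gen.
move=> f fL; rewrite [f]mpolyE big_seq.
apply: ideal_sumr => // m /fL[g Jg gm].
rewrite -mul_mpolyC; apply: (is_idealMl _ iI).
by apply: sub_gen_smallest; exists g, m.
Qed.

Lemma is_ideal_initial J : is_ideal (initial J).
Proof. exact: is_ideal_gen. Qed.

Lemma initial_monomial J m : is_ideal J -> lead J m -> initial J 'X_[m].
Proof.
by move=> iJ Jm; rewrite initial_idealE // => m'; rewrite msuppX inE => /eqP ->.
Qed.

Lemma lead_sub A B m : A `<=` B -> lead A m -> lead B m.
Proof. by move=> AB [f /AB Bf fm]; exists f. Qed.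

Lemma initial_ideal_sub A B :
  is_ideal A -> is_ideal B -> A `<=` B -> initial A `<=` initial B.
Proof.
by move=> iA iB AB f; rewrite !initial_idealE // => fA m /fA; exact: lead_sub.
Qed.

Lemma initial_idealM A B f g : is_ideal A -> is_ideal B ->
  initial A f -> initial B g -> initial (A `&` B) (f * g).
Proof.
move=> iA iB; rewrite !initial_idealE //; last exact: is_ideal_setI.
move=> fA gB _ /msuppM_le/allpairsP[[a b] /= [/fA aA /gB bB ->]].
exact: leadD.
Qed.

(** The product of the two polynomials led by [m] lies in the intersection and is led
by the square of the monomial; radicality removes the square. *)
Lemma lead_setI A B m : is_ideal A -> is_ideal B -> is_radical (initial (A `&` B)) ->
  lead A m -> lead B m -> lead (A `&` B) m.
Proof.
move=> iA iB rad Am Bm; have iAB := is_ideal_setI iA iB.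
have : initial (A `&` B) 'X_[m].
  apply: (rad _ 2%N); rewrite expr2 -mpolyXD; apply: initial_monomial => //.
  exact: leadD.
by rewrite initial_idealE //; apply; rewrite msuppX mem_head.
Qed.

(** Otherwise take an element of [K] outside [J] with least leading exponent and
cancel its leading term with an element of [J]. *)
Lemma lead_ideal_sub J K : is_ideal J -> is_ideal K -> J `<=` K ->
  (forall m, lead K m -> lead J m) -> K `<=` J.
Proof.
move=> iJ iK JK leadKJ f Kf; apply: contrapT => nJf.
have [|m [g [Kg nJg gm]] mmin] := term_order_min ordle
    (P := [set m | exists g, [/\ K g, ~ J g & initial_exponent le g m]]).
  have [|m fm] := @initial_exponent_ex f; last by exists m, f.
  by apply: contra_notN nJf => /eqP ->; exact: is_ideal0.
have [h Jh hm] : lead J m by apply: leadKJ; exists g.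
have [c gh] := initial_exponent_cancel gm hm.
have Jch : J (c *: h) by rewrite -mul_mpolyC; exact: is_idealMl.
have nJgh : ~ J (g - c *: h).
  by move=> Jgh; apply: nJg; rewrite -(subrK (c *: h) g); exact: is_idealD.
have [|m' m'gh] := @initial_exponent_ex (g - c *: h).
  by apply: contra_notN nJgh => /eqP ->; exact: is_ideal0.
have [m'm] := gh m' (proj1 m'gh); apply; apply: le_anti; rewrite m'm mmin //.
by exists (g - c *: h); split=> //; apply: is_idealB => //; exact: JK.
Qed.

(** Among all ways to write an element of the sum as [g + h], take one that
minimizes a bound [M] of the exponents of [g] and [h]. If [M] is not the leading
exponent [m], the terms at [M] cancel, so [g] and [h] are both led by [M], and so is
some [c] in the intersection. Moving a multiple of [c] from [g] to [h] removes [M]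
from both, against minimality. *)
Lemma lead_ideal_sum A B m : is_ideal A -> is_ideal B ->
    (forall m, lead A m -> lead B m -> lead (A `&` B) m) ->
  lead (ideal_sum A B) m -> lead A m \/ lead B m.
Proof.
move=> iA iB leadAB [f ABf fm].
pose bounded M := exists g h, [/\ A g, B h, f = g + h
  & forall m', m' \in msupp g ++ msupp h -> le m' M].
have sub_supp g h : f = g + h -> m \in msupp g ++ msupp h.
  by move=> fE; apply: msuppD_le; rewrite -fE; case: fm.
have bounded_max g h : A g -> B h -> f = g + h ->
    exists2 M, M \in msupp g ++ msupp h & bounded M.
  move=> Ag Bh fE; have [M MP Mmax] := term_order_seq_max ordle (sub_supp g h fE).
  by exists M => //; exists g, h.
have [|M [g [h [Ag Bh fE gM]]] Mmin] := term_order_min ordle (P := bounded).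
  case: ABf => g Ag [h Bh fE].
  by have [M _ Mb] := bounded_max g h Ag Bh (esym fE); exists M.
(* By minimality of [M], it occurs whenever it is a bound. *)
have M_in g' h' : A g' -> B h' -> f = g' + h' ->
    (forall m', m' \in msupp g' ++ msupp h' -> le m' M) -> M \in msupp g' ++ msupp h'.
  move=> Ag' Bh' fE' g'M; have [M' M'in M'b] := bounded_max _ _ Ag' Bh' fE'.
  by have <- : M' = M by apply: le_anti; rewrite g'M // Mmin.
have gM1 m' : m' \in msupp g -> le m' M.
  by move=> m'g; apply: gM; rewrite mem_cat m'g.
have hM1 m' : m' \in msupp h -> le m' M.
  by move=> m'h; apply: gM; rewrite mem_cat m'h orbT.
have [<-|mM] := pselect (M = m).
  have := M_in g h Ag Bh fE gM; rewrite mem_cat => /orP[Mg|Mh].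
    by left; exists g.
  by right; exists h.
have Mf0 : f@_M = 0.
  apply: memN_msupp_eq0; apply/negP => /(proj2 fm) Mm; apply: mM; apply: le_anti.
  by rewrite Mm gM //; exact: sub_supp fE.
have [Mg Mh] : M \in msupp g /\ M \in msupp h.
  have hg : h@_M = - g@_M by apply/eqP; rewrite -addr_eq0 addrC -mcoeffD -fE Mf0.
  have := M_in g h Ag Bh fE gM.
  by rewrite mem_cat !mcoeff_msupp hg oppr_eq0 orbb => Mg; split.
have [c [Ac Bc] cM] : lead (A `&` B) M by apply: leadAB; [exists g | exists h].
have [x gc] := initial_exponent_cancel (conj Mg gM1) cM.
have xc (K : set S) : is_ideal K -> K c -> K (x *: c).
  by move=> iK Kc; rewrite -mul_mpolyC; exact: is_idealMl.
have fE' : f = (g - x *: c) + (h + x *: c) by rewrite addrACA addNr addr0.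
have Mg' : M \notin msupp (g - x *: c) by apply/negP => /gc[_]; apply.
have Mh' : M \notin msupp (h + x *: c).
  have := Mf0; rewrite {1}fE' mcoeffD (memN_msupp_eq0 Mg') add0r => e.
  by rewrite mcoeff_msupp e eqxx.
have := M_in (g - x *: c) (h + x *: c) _ _ fE' _.
rewrite mem_cat (negPf Mg') (negPf Mh') => /(_ _ _ _)/= absurd.
exfalso; suff : false by [].
apply: absurd.
- exact: is_idealB (xc A iA Ac).
- exact: is_idealD (xc B iB Bc).
- move=> m'; rewrite mem_cat => /orP[/gc[]//|/msuppD_le].
  by rewrite mem_cat => /orP[/hM1//|/msuppZ_le/(proj2 cM)].
Qed.

(** If every set of [#|U|] variables supported a leading monomial of [J], then
[algebraic_dependence] would relate the variables of [U] modulo [J]. *)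
Lemma independent_initial J U : is_ideal J -> independent J U ->
  exists U', (#|U| <= #|U'|)%N /\ forall m, lead J m -> ~ supported_in U' m.
Proof.
move=> iJ indU; have [U0|U_gt0] := posnP #|U|.
  exists U; split=> // m [f Jf [mf fm]] mU.
  have m0 : m = 0%MM.
    apply/mnmP => i; rewrite mnm0E mU //.
    by rewrite (cards0_eq U0) inE.
  move: mf; rewrite (indU f) ?msupp0 // => m' /fm m'm i _.
  have : m' = 0%MM.
    apply: le_anti; rewrite -{1}m0 m'm; apply: term_order_dvd => //.
    by apply/mnm_lepP => j; rewrite mnm0E.
  by move=> ->; rewrite mnm0E.
(* The count is applied with [N + 1 = #|U|], which excludes the empty [U]. *)
apply: contrapT => no.
have [||P [P0 JP]] :=
  @algebraic_dependence k n le ordle J #|U|.-1 #|U| (@variables_of k n U) iJ.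
- move=> A cA; apply: contrapT => noA; apply: no; exists A.
  split=> [|m [f Jf fm] mA]; first by rewrite cA prednK.
  by apply: noA; exists f, m.
- by rewrite ltn_predL.
- by move/eqP: P0; apply; exact: independent_variables JP.
Qed.

(** For a prime [q] containing [J], an independent set of [q] of size at least
[n - height q] gives one of the same size whose variables support no leading
monomial of [q], hence none of [J]. *)
Lemma height_initial_le J :
  is_ideal J -> enat_le (ideal_height (initial J)) (ideal_height J).
Proof.
move=> iJ; apply: enat_inf_glb => _ [q [qP Jq] <-].
have iq := prime_idealW qP.
have [U [indU Uq]] := prime_independent_set qP.
have [U' [UU' leadU']] := independent_initial iq indU.
apply: enat_le_trans Uq.
apply: enat_le_trans (_ : enat_le (Fin (n - #|U'|)) _); last first.
  exact: leq_sub2l.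
apply: ideal_height_independent; first exact: is_ideal_initial.
move=> f; rewrite initial_idealE // => fJ fU'.
apply/eqP/negPn/negP => /initial_exponent_ex[m [mf _]].
have qm : lead q m by apply: lead_sub Jq _; exact: fJ.
by case: (leadU' m qm); exact: fU'.
Qed.

(** An independent set [U] of [q] is independent for the sum: otherwise a leading
monomial of the sum would be a monomial in the variables of [U] lying in
[initial A] or [initial B], hence in [q]. *)
Lemma height_sum_le A B q : is_ideal A -> is_ideal B ->
    is_radical (initial (A `&` B)) -> is_prime q ->
    initial A `<=` q -> initial B `<=` q ->
  enat_le (ideal_height (ideal_sum A B)) (prime_height q).
Proof.
move=> iA iB rad qP Aq Bq; have [U [indU Uq]] := prime_independent_set qP.
apply: enat_le_trans Uq; apply: ideal_height_independent; first exact: is_ideal_sum.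
move=> f ABf fU; apply/eqP/negPn/negP => /initial_exponent_ex[m fm].
have qm : q 'X_[m].
  have [Am|Bm] : lead A m \/ lead B m.
    apply: lead_ideal_sum => //; last by exists f.
    by move=> m' Am' Bm'; exact: lead_setI.
  - by apply: Aq; exact: initial_monomial.
  - by apply: Bq; exact: initial_monomial.
have /mpolyP/(_ m) : 'X_[m] = 0 :> S.
  apply: indU qm _ => m'; rewrite msuppX inE => /eqP ->.
  by apply: fU; case: fm.
by rewrite mcoeffX eqxx mcoeff0 => /eqP; rewrite oner_eq0.
Qed.

End InitialIdeals.

(** * Minimal primes *)
Section MinimalPrimes.
Import GRing.Theory.
Local Open Scope ring_scope.

(** The usual product argument, with a parameter [Phi] so that it covers both
intersections of ideals and initial ideals of intersections. *)
Lemma prime_finite_bigcap (R : comNzRingType) (T : eqType) (Phi : set R -> set R)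
    (K : T -> set R) (q : set R) (r : seq T) :
    (forall A B, is_ideal A -> is_ideal B ->
      forall f g, Phi A f -> Phi B g -> Phi (A `&` B) (f * g)) ->
    Phi setT 1 -> (forall l, is_ideal (K l)) -> is_prime q ->
    Phi (\bigcap_(l in [set` r]) K l) `<=` q ->
  exists2 l, l \in r & Phi (K l) `<=` q.
Proof.
move=> PhiM Phi1 iK [iq q1 qM].
elim: r => [|l r IH] rq.
  by case: q1; apply: rq; rewrite (_ : bigcap _ _ = setT) //; apply/seteqP; split.
have [lq|/existsNP[f /not_implyP[lf nqf]]] := pselect (Phi (K l) `<=` q).
  by exists l; rewrite ?mem_head.
have [|l' l'r l'q] := IH; last by exists l'; rewrite // inE l'r orbT.
move=> g rg; suff : q (f * g) by move=> /qM[].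
apply: rq; rewrite (_ : bigcap _ _ = K l `&` \bigcap_(l in [set` r]) K l).
  by apply: PhiM => //; exact: is_ideal_bigcap.
apply/seteqP; split=> [h rh|h [lh rh] m]; first split.
- by apply: rh; rewrite /= mem_head.
- by move=> m mr; apply: rh; rewrite /= inE [m \in r]mr orbT.
- by rewrite /= inE => /predU1P[->|/rh].
Qed.

Variables (k : fieldType) (n : nat).
Implicit Types (J q : set {mpoly k[n]}).

(** A prime of least height between [J] and [q] is minimal over [J]. *)
Lemma minimal_prime_below J q : is_prime q -> J `<=` q ->
  exists2 q', minimal_prime J q' & q' `<=` q.
Proof.
move=> qP Jq.
pose between d := `[< exists q', [/\ is_prime q', J `<=` q', q' `<=` q
  & prime_height q' = Fin d] >].
have ex_between : exists d, between d.
  have [d qd] := prime_height_finite qP; exists d; apply/asboolP.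
  by exists q; split=> //; exact: subset_refl.
case: (ex_minnP ex_between) => d /asboolP[q' [q'P Jq' q'q q'd]] dmin.
exists q' => //; split=> // q'' q''P Jq'' q''q'; apply: contrapT => neq.
have q''lt : q'' `<` q'.
  by split=> // q'q''; apply: neq; apply/seteqP; split.
have [e q''e] := prime_height_finite q''P.
have := prime_height_lt q''P q'P q''lt; rewrite q''e q'd /= ltnNge => /negP; apply.
apply: dmin; apply/asboolP; exists q''; split=> //.
exact: subset_trans q''q' q'q.
Qed.

Lemma minimal_prime_avoiding J f : is_ideal J -> is_radical J -> ~ J f ->
  exists2 q, minimal_prime J q & ~ q f.
Proof.
move=> iJ radJ nJf.
have [||q [qP Jq qf]] := @prime_avoiding _ J [set f ^+ m | m in [set: nat]] iJ.
- split; first by exists 0%N; rewrite ?expr0.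
  by move=> _ _ [a _ <-] [b _ <-]; exists (a + b)%N; rewrite ?exprD.
- by move=> g [Jg [m _ fm]]; apply: nJf; apply: (radJ _ m); rewrite fm.
have [q' q'P q'q] := minimal_prime_below qP Jq; exists q' => // q'f.
by apply: (qf f); split; [exact: q'q | exists 1%N; rewrite ?expr1].
Qed.

End MinimalPrimes.

(** * Projection of walks between dual graphs *)
Section DualGraph.
Local Open Scope ring_scope.
Import GRing.Theory.
Variables (k : fieldType) (n : nat) (I : set {mpoly k[n]}).
Variables (s : nat) (p : 'I_s -> set {mpoly k[n]}) (le : rel 'X_{1..n}).
Hypotheses (idealI : is_ideal I) (inj_p : injective p).
Hypothesis min_p : range p = [set q | minimal_prime I q].
Hypothesis decompI : I = \bigcap_(i in [set: 'I_s]) p i.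
Hypothesis ordle : term_order le.
Hypothesis radical_in : forall A : set 'I_s,
  is_radical (initial_ideal le (\bigcap_(i in A) p i)).
Local Notation initial := (initial_ideal le).

Let min_pP i : minimal_prime I (p i).
Proof. by have : range p (p i) by [exists i]; rewrite min_p. Qed.

Let prime_p i : is_prime (p i). Proof. by case: (min_pP i). Qed.

Let ideal_p i : is_ideal (p i). Proof. exact/prime_idealW/prime_p. Qed.

Let incomparable_p i j : p i `<=` p j -> i = j.
Proof.
move=> pij; apply: inj_p; have [_ _ minj] := min_pP j; apply: minj => //.
by have [] := min_pP i.
Qed.

(** The initial ideals of the components have their product inside [initial I]. *)
Lemma prime_contains_initial q : is_prime q -> initial I `<=` q ->
  exists l, initial (p l) `<=` q.
Proof.
move=> qP Iq.
have [|||||l _ lq] := @prime_finite_bigcap _ _ initial p q (enum 'I_s); last by exists l.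
- by move=> A B iA iB f g; exact: initial_idealM.
- rewrite initial_idealE // => m; rewrite msupp1 inE => /eqP ->.
  exists 1 => //; split=> [|m']; rewrite msupp1 ?mem_head // inE => /eqP ->.
  by case: ordle => -[].
- exact: ideal_p.
- exact: qP.
rewrite (_ : [set` _] = [set: 'I_s]) -?decompI //.
by apply/seteqP; split=> // l _; rewrite /= mem_enum.
Qed.

(** Let [K] be the intersection of the other components. If [initial K] were equal
to [initial I], then [K] would equal [I] and one of the other components would
lie in [p v]. So some minimal prime [q] of the radical ideal [initial I] does
not contain [initial K], and it contains [initial p v] because it contains the
product of the two. *)
Lemma private_minimal_prime v : exists q, [/\ minimal_prime (initial I) q,
  initial (p v) `<=` q & forall l, initial (p l) `<=` q -> l = v].
Proof.
pose others := [seq l <- enum 'I_s | l != v].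
pose K := \bigcap_(l in [set` others]) p l.
have iK : is_ideal K by apply: is_ideal_bigcap => l _; exact: ideal_p.
have Kv : K `&` p v = I.
  rewrite decompI; apply/seteqP; split=> [f [Kf vf] l _|f pf].
    have [->//|lv] := eqVneq l v; apply: Kf.
    by rewrite /= mem_filter lv mem_enum.
  by split=> [l _|]; exact: pf.
have KI : ~ (initial K `<=` initial I).
  move=> KI; have KI' : K `<=` I.
    apply: (lead_ideal_sub ordle) => // [f If|m Km].
      by move: If; rewrite -Kv => -[].
    have /KI := initial_monomial ordle iK Km.
    by rewrite initial_idealE //; apply; rewrite msuppX mem_head.
  have [|||||l lo lv] := @prime_finite_bigcap _ _ id p (p v) others.
  - by move=> A B iA iB f g Af Bg; split; [exact: is_idealMr | exact: is_idealMl].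
  - by [].
  - exact: ideal_p.
  - exact: prime_p.
  - by apply: subset_trans KI' _; have [] := min_pP v.
  by move: lo; rewrite mem_filter (incomparable_p lv) eqxx.
have /existsNP[f /not_implyP[Kf nIf]] := KI.
have [|q qmin nqf] := minimal_prime_avoiding (is_ideal_initial _ _) _ nIf.
  by have := @radical_in [set: 'I_s]; rewrite -decompI.
have [[_ _ qM] Iq _] := qmin.
exists q; split=> // [g vg|l lq].
  suff : q (f * g) by move=> /qM[].
  by apply: Iq; rewrite -Kv; exact: initial_idealM.
apply: contrapT => /eqP lv; apply: nqf; apply: lq.
apply: initial_ideal_sub Kf => // h Kh; apply: Kh.
by rewrite /= mem_filter lv mem_enum.
Qed.

(** The upper bound uses [height_sum_le] for the primes above [q + q']; the lower
bound holds because a prime containing both components contains [p l] properly. *)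
Lemma height_sum_adjacent l l' q q' : l <> l' ->
    initial (p l) `<=` q -> initial (p l') `<=` q' -> is_ideal q -> is_ideal q' ->
    ideal_height (ideal_sum q q') = enat_succ (ideal_height (initial I)) ->
  ideal_height (ideal_sum (p l) (p l')) = enat_succ (ideal_height I).
Proof.
move=> ll' lq l'q' iq iq' qq'; apply: enat_le_anti.
  apply: enat_le_trans (enat_le_succ2 (height_initial_le ordle idealI)).
  rewrite -qq'; apply: enat_inf_glb => _ [r [rP qr] <-].
  apply: (height_sum_le ordle (ideal_p l) (ideal_p l')) => //.
  - rewrite (_ : p l `&` p l' = \bigcap_(i in [set l; l']) p i) //.
    apply/seteqP; split=> [f [lf l'f] i [->|->]//|f pf].
    by split; apply: pf; [left | right].
  - by apply: subset_trans lq _; apply: subset_trans qr; exact: ideal_sumSl.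
  - by apply: subset_trans l'q' _; apply: subset_trans qr; exact: ideal_sumSr.
apply: enat_inf_glb => _ [r [rP pr] <-].
have lr : p l `<=` r by apply: subset_trans pr; exact: ideal_sumSl.
have l'r : p l' `<=` r by apply: subset_trans pr; exact: ideal_sumSr.
apply: enat_le_trans (prime_height_lt (prime_p l) rP _); last first.
  split=> // rl; apply: ll'; apply/esym/incomparable_p.
  exact: subset_trans l'r rl.
apply: enat_le_succ2; apply: enat_inf_lb; exists (p l) => //.
by have [] := min_pP l.
Qed.

Definition component i : {q : set {mpoly k[n]} | minimal_prime I q} :=
  exist _ (p i) (min_pP i).

Lemma component_surj u : exists i, u = component i.
Proof.
case: u => q qmin; have [i _ pi] : range p q by rewrite min_p.
by exists i; case: _ / pi in qmin *; congr exist; exact: Prop_irrelevance.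
Qed.

(** Choose for each vertex of the walk a component whose initial ideal it
contains. Consecutive components are adjacent or equal, and the last choice is
forced to be [v]. *)
Lemma lift_walk (w : seq {q : set {mpoly k[n]} | minimal_prime (initial I) q}) q l v :
    initial (p l) `<=` sval q ->
    (forall l', initial (p l') `<=` sval (last q w) -> l' = v) ->
    path (@dual_graph _ (initial I)) q w ->
  exists w', [/\ path (@dual_graph _ I) (component l) w',
    last (component l) w' = component v & (size w' <= size w)%N].
Proof.
elim: w q l => [|q' w IH] q l lq wv; first by rewrite (wv l lq); exists [::].
move=> /= /andP[/asboolP[_ qq'] w_path].
have [q'P Iq' _] := svalP q'; have [qP _ _] := svalP q.
have [l' l'q'] := prime_contains_initial q'P Iq'.
have [w' [w'_path w'v w'w]] := IH q' l' l'q' wv w_path.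
have [ll'|ll'] := eqVneq l l'.
  by exists w'; rewrite ll'; split=> //; exact: leqW.
exists (component l' :: w'); split=> //=; rewrite w'_path andbT.
apply/asboolP; split=> /=; first by move=> /inj_p/eqP; apply/negP.
apply: height_sum_adjacent lq l'q' _ _ qq'; first exact/eqP.
  exact: prime_idealW qP.
exact: prime_idealW q'P.
Qed.

Lemma diam_le_initial : enat_le (ideal_diam I) (ideal_diam (initial I)).
Proof.
case diam: (ideal_diam (initial I)) => [d|]; last by case: (ideal_diam I).
apply: enat_sup_lub => _ [[u v] _ <-] /=.
have [i ->] := component_surj u; have [j ->] := component_surj v.
have [q [qmin iq _]] := private_minimal_prime i.
have [r [rmin _ rj]] := private_minimal_prime j.
pose Q := exist (minimal_prime (initial I)) q qmin.
pose R := exist (minimal_prime (initial I)) r rmin.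
have QR : enat_le (graph_dist (@dual_graph _ (initial I)) Q R) (Fin d).
  by rewrite -diam; apply: enat_sup_ub; exists (Q, R).
have [m md [w [w_path wR] [wm]]] := enat_inf_attained QR.
have [|w' [w'_path w'j w'w]] := @lift_walk w Q i j iq _ w_path.
  by rewrite wR.
apply: enat_le_trans (_ : enat_le (Fin (size w')) _).
  by apply: enat_inf_lb; exists w'.
by apply: leq_trans w'w _; rewrite wm.
Qed.

End DualGraph.

Unset Implicit Arguments.

Theorem theorem3p3 (k : fieldType) (n : nat) (I : set {mpoly k[n]})
    (s : nat) (p : 'I_s -> set {mpoly k[n]}) (le : rel 'X_{1..n})
    (idealI : is_ideal I) (properI : is_proper I) (radicalI : is_radical I)
    (inj_p : injective p)
    (min_p : range p = [set q | minimal_prime I q])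
    (decompI : I = \bigcap_(i in [set: 'I_s]) p i)
    (ordle : term_order le)
    (radical_in : forall A : set 'I_s,
      is_radical (initial_ideal le (\bigcap_(i in A) p i))) :
  enat_le (ideal_diam I) (ideal_diam (initial_ideal le I)).
Proof. exact: (diam_le_initial idealI inj_p min_p decompI ordle radical_in). Qed.
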